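(* Let $\overline{M}$ be a complex space form of real dimension $n+p$, with Kaehler structure $(J,\overline{g})$ and constant holomorphic sectional curvature $4c$, and let $M$ be an $n$-dimensional $CR$ submanifold of maximal $CR$ dimension in $\overline{M}$, where $n\geq 3$. If the second fundamental form $h$ of $M$ satisfies $h(JX,Y)=Jh(X,Y)$ for all $X,Y\in T(M)$, where $h(JX,Y)$ is understood as $h(FX,Y)$ with $FX$ the tangential component of $JX$, then $\overline{M}$ is a Euclidean space, in the sense that $c=0$.
   Context: A complex space form is a Kaehler manifold $\overline{M}$ with complex structure $J$ and Kaehler metric $\overline{g}$, of constant holomorphic sectional curvature, denoted $4c$ with $c\in\mathbb{R}$. All dimensions of manifolds are real dimensions, and $n,p$ are positive integers. Let $M$ be an $n$-dimensional real submanifold immersed in $\overline{M}$, with the induced Riemannian metric $g$. For $x\in M$ put $H_x(M)=JT_x(M)\cap T_x(M)$, the maximal $J$-invariant subspace of $T_x(M)$. $M$ is called a $CR$ submanifold of maximal $CR$ dimension if $\dim_{\mathbb{C}}H_x(M)=\frac{n-1}{2}$ for every $x\in M$ (so $n$ is odd). In this case there is a unit vector field $\xi$ normal to $M$ such that $JT_x(M)\subset T_x(M)\oplus\mathrm{span}\{\xi_x\}$ for every $x\in M$; this $\xi$ is called the distinguished vector field. For $X$ tangent to $M$ one writes $JX=FX+u(X)\xi$, with $FX$ tangent to $M$; $F$ is a skew-symmetric endomorphism of $T(M)$ and $u$ is a one-form on $M$. Let $\overline{\nabla}$ and $\nabla$ be the Levi-Civita connections of $\overline{M}$ and $M$. The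 second fundamental form $h$ is the symmetric normal-bundle-valued form defined by $\overline{\nabla}_XY=\nabla_XY+h(X,Y)$ for $X,Y$ tangent to $M$. The equation $h(FX,Y)=Jh(X,Y)$ is an equality of vectors in $T(\overline{M})$ along $M$; the right-hand side may a priori have a tangential component. *)

(* Defs.v *)
From mathcomp Require Import all_boot all_order all_algebra.
From mathcomp Require Import all_classical all_reals all_analysis.

Set Implicit Arguments.
Unset Strict Implicit.
Unset Printing Implicit Defensive.
Import Order.TTheory GRing.Theory Num.Theory.
Import numFieldNormedType.Exports.

Local Open Scope classical_set_scope.
Local Open Scope ring_scope.

(* Conventions.  Vectors are rows and linear maps act on the right: a tangent
   vector X at a point with coordinates y has components X : 'rV_n in a chart,
   its image under the differential of a map F is X *m 'J F y, and its image
   under an endomorphism A is X *m A.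
   Tensor fields on a manifold are families of component functions, one per
   chart of the atlas, related by the usual transformation law. *)

(** * Smooth functions on open subsets of R^m *)

(* Meant for open U: only then does 'D_v f x depend on the restriction of f
   to U alone. *)
Fixpoint class_C (R : realType) (m : nat) (W : normedModType R) (k : nat)
    (U : set 'rV[R]_m) (f : 'rV[R]_m -> W) : Prop :=
  if k is k'.+1 then
    (forall x, U x -> differentiable f x) /\
    (forall v, class_C k' U ('D_v f))
  else {within U, continuous f}.

Definition smooth_on (R : realType) (m : nat) (W : normedModType R)
    (U : set 'rV[R]_m) (f : 'rV[R]_m -> W) : Prop :=
  forall k, class_C k U f.

(** * Smooth manifolds *)

(* [chart_map] is a homeomorphism from the open set [chart_dom] onto the open
   set [chart_cod], with inverse [chart_inv]; the values of [chart_map] outside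
   [chart_dom] and of [chart_inv] outside [chart_cod] are irrelevant. *)
Record chart (R : realType) (n : nat) (T : topologicalType) := Chart {
  chart_dom : set T;
  chart_cod : set 'rV[R]_n;
  chart_map : T -> 'rV[R]_n;
  chart_inv : 'rV[R]_n -> T;
  chart_dom_open : open chart_dom;
  chart_cod_open : open chart_cod;
  chart_mapP : forall x, chart_dom x -> chart_cod (chart_map x);
  chart_invP : forall y, chart_cod y -> chart_dom (chart_inv y);
  chart_mapK : forall x, chart_dom x -> chart_inv (chart_map x) = x;
  chart_invK : forall y, chart_cod y -> chart_map (chart_inv y) = y;
  chart_map_cont : {within chart_dom, continuous chart_map};
  chart_inv_cont : {within chart_cod, continuous chart_inv}
}.

(* Expression in charts a, b of a map f, and the open set where it is
   meaningful. *)
Definition local_dom (R : realType) (n m : nat) (S T : topologicalType)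
    (f : S -> T) (a : chart R n S) (b : chart R m T) : set 'rV[R]_n :=
  [set y | chart_cod a y /\ chart_dom b (f (chart_inv a y))].

Definition local_rep (R : realType) (n m : nat) (S T : topologicalType)
    (f : S -> T) (a : chart R n S) (b : chart R m T) : 'rV[R]_n -> 'rV[R]_m :=
  fun y => chart_map b (f (chart_inv a y)).

(* Manifolds are Hausdorff, second countable and nonempty, but are not
   required to be connected; the atlas need not be maximal. *)
Record manifold (R : realType) (n : nat) := Manifold {
  mfd_space :> topologicalType;
  mfd_inhabited : inhabited mfd_space;
  mfd_hausdorff : hausdorff_space mfd_space;
  mfd_second_countable : @second_countable mfd_space;
  mfd_index : Type;
  mfd_chart : mfd_index -> chart R n mfd_space;
  mfd_cover : forall x, exists a, chart_dom (mfd_chart a) x;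
  mfd_compat : forall a b,
    smooth_on (local_dom id (mfd_chart a) (mfd_chart b))
              (local_rep id (mfd_chart a) (mfd_chart b))
}.

Definition smooth_map (R : realType) (n m : nat)
    (M : manifold R n) (N : manifold R m) (f : M -> N) : Prop :=
  continuous f /\
  forall (a : mfd_index M) (b : mfd_index N),
    smooth_on (local_dom f (mfd_chart a) (mfd_chart b))
              (local_rep f (mfd_chart a) (mfd_chart b)).

Definition immersion (R : realType) (n m : nat)
    (M : manifold R n) (N : manifold R m) (f : M -> N) : Prop :=
  smooth_map f /\
  forall (a : mfd_index M) (b : mfd_index N) (y : 'rV[R]_n),
    local_dom f (mfd_chart a) (mfd_chart b) y ->
    row_free ('J (local_rep f (mfd_chart a) (mfd_chart b)) y).

(** * Riemannian geometry of a metric G on an open subset of R^n *)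

Definition bform (R : realType) (n : nat) (A : 'M[R]_n) (X Y : 'rV[R]_n) : R :=
  (X *m A *m Y^T) 0 0.

(* Gamma(X, Y)^k = Gamma^k_ij X^i Y^j, with
   Gamma_ijl = (d_i G_jl + d_j G_il - d_l G_ij) / 2. *)
Definition christoffel (R : realType) (n : nat) (G : 'rV[R]_n -> 'M[R]_n)
    (x X Y : 'rV[R]_n) : 'rV[R]_n :=
  (\row_(l < n)
     (2^-1 * ('D_X (fun z => bform (G z) Y (delta_mx 0 l)) x
            + 'D_Y (fun z => bform (G z) X (delta_mx 0 l)) x
            - 'D_(delta_mx 0 l) (fun z => bform (G z) X Y) x)))
  *m invmx (G x).

(* Levi-Civita covariant derivative of the vector field V in the direction of
   the vector X at x. *)
Definition nabla (R : realType) (n : nat) (G : 'rV[R]_n -> 'M[R]_n)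
    (X : 'rV[R]_n) (V : 'rV[R]_n -> 'rV[R]_n) (x : 'rV[R]_n) : 'rV[R]_n :=
  'D_X V x + christoffel G x X (V x).

(* R(X, Y) Z = nabla_X nabla_Y Z - nabla_Y nabla_X Z - nabla_[X, Y] Z, computed
   on the extensions of X, Y, Z with constant components, so that [X, Y] = 0. *)
Definition curvature (R : realType) (n : nat) (G : 'rV[R]_n -> 'M[R]_n)
    (x X Y Z : 'rV[R]_n) : 'rV[R]_n :=
  nabla G X (nabla G Y (cst Z)) x - nabla G Y (nabla G X (cst Z)) x.

Definition sectional_curvature (R : realType) (n : nat)
    (G : 'rV[R]_n -> 'M[R]_n) (x X Y : 'rV[R]_n) : R :=
  bform (G x) (curvature G x X Y Y) X /
  (bform (G x) X X * bform (G x) Y Y - bform (G x) X Y ^+ 2).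

(** * Kaehler manifolds and complex space forms *)

(* Riemannian metric with an orthogonal almost complex structure J which is
   parallel for the Levi-Civita connection (hence integrable); [kJ_parallel]
   reads (nabla_X J) Y = nabla_X (J Y) - J (nabla_X Y) = 0, for Y with constant
   components. *)
Record kaehlerManifold (R : realType) (N : nat) := KaehlerManifold {
  kmfd :> manifold R N;
  kg : mfd_index kmfd -> 'rV[R]_N -> 'M[R]_N;
  kJ : mfd_index kmfd -> 'rV[R]_N -> 'M[R]_N;
  kg_smooth : forall a, smooth_on (chart_cod (mfd_chart a)) (kg a);
  kg_sym : forall a x, chart_cod (mfd_chart a) x -> (kg a x)^T = kg a x;
  kg_pos : forall a x, chart_cod (mfd_chart a) x ->
    forall X, X != 0 -> 0 < bform (kg a x) X X;
  kg_compat : forall a b x,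
    local_dom id (mfd_chart a) (mfd_chart b) x ->
    let tau := local_rep id (mfd_chart a) (mfd_chart b) in
    kg a x = 'J tau x *m kg b (tau x) *m ('J tau x)^T;
  kJ_smooth : forall a, smooth_on (chart_cod (mfd_chart a)) (kJ a);
  kJ_compat : forall a b x,
    local_dom id (mfd_chart a) (mfd_chart b) x ->
    let tau := local_rep id (mfd_chart a) (mfd_chart b) in
    kJ a x *m 'J tau x = 'J tau x *m kJ b (tau x);
  kJ_sqr : forall a x, chart_cod (mfd_chart a) x ->
    kJ a x *m kJ a x = - 1%:M;
  kJ_hermitian : forall a x, chart_cod (mfd_chart a) x ->
    forall X Y,
      bform (kg a x) (X *m kJ a x) (Y *m kJ a x) = bform (kg a x) X Y;
  kJ_parallel : forall a x, chart_cod (mfd_chart a) x ->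
    forall X Y,
      nabla (kg a) X (fun z => Y *m kJ a z) x
      - nabla (kg a) X (cst Y) x *m kJ a x = 0
}.

Definition constant_holomorphic_curvature (R : realType) (N : nat)
    (M : kaehlerManifold R N) (k : R) : Prop :=
  forall (a : mfd_index M) (x : 'rV[R]_N), chart_cod (mfd_chart a) x ->
  forall X, X != 0 -> sectional_curvature (kg a) x X (X *m kJ a x) = k.

(** * Submanifolds *)

Definition induced_metric (R : realType) (n N : nat)
    (G : 'rV[R]_N -> 'M[R]_N) (F : 'rV[R]_n -> 'rV[R]_N) :
    'rV[R]_n -> 'M[R]_n :=
  fun y => 'J F y *m G (F y) *m ('J F y)^T.

(* Ambient covariant derivative, in the direction of the vector X tangent to
   the submanifold at y, of a field V of ambient vectors along F. *)
Definition nabla_along (R : realType) (n N : nat)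
    (G : 'rV[R]_N -> 'M[R]_N) (F : 'rV[R]_n -> 'rV[R]_N)
    (X : 'rV[R]_n) (V : 'rV[R]_n -> 'rV[R]_N) (y : 'rV[R]_n) : 'rV[R]_N :=
  'D_X V y + christoffel G (F y) (X *m 'J F y) (V y).

(* h(X, Y), the difference of the ambient covariant derivative of F_* Y and of
   F_* (nabla_X Y), computed on the extension of Y with constant components. *)
Definition second_fundamental_form (R : realType) (n N : nat)
    (G : 'rV[R]_N -> 'M[R]_N) (F : 'rV[R]_n -> 'rV[R]_N)
    (y X Y : 'rV[R]_n) : 'rV[R]_N :=
  nabla_along G F X (fun z => Y *m 'J F z) y
  - nabla (induced_metric G F) X (cst Y) y *m 'J F y.

(* Z is the tangential component of the ambient vector V at y, i.e. V - F_* Z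
   is normal. *)
Definition tangential_component (R : realType) (n N : nat)
    (G : 'rV[R]_N -> 'M[R]_N) (F : 'rV[R]_n -> 'rV[R]_N)
    (y : 'rV[R]_n) (V : 'rV[R]_N) (Z : 'rV[R]_n) : Prop :=
  forall W : 'rV[R]_n, bform (G (F y)) (V - Z *m 'J F y) (W *m 'J F y) = 0.

(* The J-invariant row space of H has complex dimension k: it has a basis
   B_1, ..., B_k over C, i.e. B_1, ..., B_k, J B_1, ..., J B_k is a basis
   over R. *)
Definition complex_dim (R : realType) (N : nat) (J H : 'M[R]_N) (k : nat) :
    Prop :=
  exists B : 'M[R]_(k, N),
    row_free (col_mx B (B *m J)) /\ (col_mx B (B *m J) == H)%MS.

(* The tangent space of the submanifold is the row space of the Jacobian;
   [k.*2.+1 = n] says that k = (n - 1) / 2. *)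
Definition maximal_CR_dimension (R : realType) (n N : nat)
    (M : manifold R n) (Mbar : kaehlerManifold R N) (f : M -> Mbar) : Prop :=
  forall (a : mfd_index M) (b : mfd_index Mbar) (y : 'rV[R]_n),
    local_dom f (mfd_chart a) (mfd_chart b) y ->
    let F := local_rep f (mfd_chart a) (mfd_chart b) in
    let T := 'J F y in
    let J := kJ b (F y) in
    exists k : nat, k.*2.+1 = n /\ complex_dim J ((T *m J) :&: T)%MS k.

(* h(FX, Y) = J h(X, Y), where FX denotes the tangential component of JX. *)
Definition h_complex_linear (R : realType) (n N : nat)
    (M : manifold R n) (Mbar : kaehlerManifold R N) (f : M -> Mbar) : Prop :=
  forall (a : mfd_index M) (b : mfd_index Mbar) (y : 'rV[R]_n),
    local_dom f (mfd_chart a) (mfd_chart b) y ->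
    let F := local_rep f (mfd_chart a) (mfd_chart b) in
    let J := kJ b (F y) in
    let h := second_fundamental_form (kg b) F y in
    forall X FX Y : 'rV[R]_n,
      tangential_component (kg b) F y (X *m 'J F y *m J) FX ->
      h FX Y = h X Y *m J.

(* Main.v *)
From HB Require Import structures.
Require Import Defs.
From mathcomp Require Import all_boot all_order all_algebra.
From mathcomp Require Import all_classical all_reals all_analysis.
From mathcomp Require Import ring lra.
Import Order.TTheory GRing.Theory Num.Theory.
Import numFieldNormedType.Exports.
Local Open Scope classical_set_scope.
Local Open Scope ring_scope.

Set Implicit Arguments.
Unset Strict Implicit.
Unset Printing Implicit Defensive.

(** Read the immersion in charts.  Let e_X be the image of the tangent vector X
    ([push X y] at the point y) and D the covariant derivative of the ambient
    metric g along the immersion.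

    The vector h(X, Y) is normal, and so is J h(X, Y), which is h(X', Y) with X'
    the tangential component of J e_X; hence

      (1)  g(h(X, Y), J e_Z) = 0   for all tangent X, Y, Z.

    Since n is odd, the skew form (X, Y) |-> g(J e_X, e_Y) is degenerate at
    each point; let u be a nonzero vector in its kernel at a point y.  Then J e_u is
    normal: it is the distinguished normal direction.  The tangential component
    of J e_u vanishes, so J h(u, Y) = h(0, Y) = 0 and u lies in the kernel of h.

    Differentiate (1) at y in a direction W and take Z = u.  As
    D_W e_u = e_(nabla_W u) + h(W, u) is tangent, (1) kills the term where
    J e_u is differentiated, so g(D_W (h(X, Y)), J e_u) = 0.  The tangential
    part of D_X e_Y contributes to g(D_W D_X e_Y, J e_u) only tangent vectors
    and values of h, both orthogonal to J e_u.  Therefore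
    g(D_W D_X e_Y, J e_u) = 0 for all W, X, Y, and skew-symmetrizing in W and X,

      (2)  g(Rbar(e_W, e_X) e_Y, J e_u) = 0.

    This is the component of the Codazzi equation along J e_u, but its derivation
    takes u at the single point y, without a local field extending it.

    Because n >= 3 there is a nonzero tangent vector b with J b tangent, and it
    is orthogonal to e_u and to J e_u.  In a Kaehler manifold of constant
    holomorphic curvature 4c, polarization of the quartic form
    g(Rbar(X, JX) JX, X) = 4c g(X, X)^2 gives
    g(Rbar(b, Jb) J e_u, e_u) = 2c g(b, b) g(e_u, e_u) for such b
    ([space_form_curvature]).  By (2) with e_W = b, e_X = J b and Y = u
    ([curvature_characteristic]) the left-hand side is zero, so c = 0.

    The analytic input is the equality of mixed second derivatives
    ([derive_comm]); from it come the torsion-freeness of D and the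
    formula D_W D_X V - D_X D_W V = Rbar(e_W, e_X) V for a vector field V
    along the immersion ([curvature_along]).  The latter, applied to the identity map, also
    shows that the curvature commutes with J ([curvature_J]). *)

(** * Directional derivatives of vector-valued functions *)

Section Calculus.
Context {R : realType}.
Implicit Types V W : normedModType R.

(** The difference of the two maps vanishes near x, hence has differential 0. *)
Lemma near_eq_differentiable V W (f g : V -> W) x :
  {near x, f =1 g} -> differentiable f x -> differentiable g x.
Proof.
move=> fg df; pose d := g - f.
suff dd : differentiable d x.
  have -> : g = f + d by apply/funext => z; rewrite /d !fctE addrC subrK.
  exact: differentiableD.
have d0 : {near x, d =1 cst 0}.
  by near=> z; rewrite /d !fctE; near: z; apply: filterS fg => z ->; rewrite subrr.
have dx : d \o shift x = cst (d x) + (0 : V -> W) +o_ 0 id.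
  apply/eqaddoP => e e0; near=> z; rewrite /= !fctE /= addr0 (nbhs_singleton d0) subr0.
  have -> : d (z + x) = 0.
    near: z; move: d0; rewrite (near_shift 0) /= => d0.
    by apply: filterS d0 => z /=; rewrite subr0.
  by rewrite normr0 mulr_ge0// ltW.
have dE : 'd d x = (0 : V -> W) :> (V -> W).
  by apply: diff_unique dx; exact: cst_continuous.
apply/diff_locallyP; rewrite dE; split => //.
exact: cst_continuous.
Unshelve. all: by end_near. Qed.

Lemma near_open V (U : set V) (x : V) (P : V -> Prop) :
  open U -> U x -> (forall z, U z -> P z) -> \forall z \near x, P z.
Proof.
by move=> Uo Ux UP; have := open_nbhs_nbhs (conj Uo Ux); apply: filterS.
Qed.

Lemma open_eq_differentiable V W (U : set V) (f g : V -> W) x :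
  open U -> U x -> (forall z, U z -> f z = g z) ->
  differentiable f x -> differentiable g x.
Proof. by move=> Uo Ux /(near_open Uo Ux); exact: near_eq_differentiable. Qed.

Lemma open_eq_derive V W (U : set V) (f g : V -> W) x v :
  open U -> U x -> (forall z, U z -> f z = g z) -> 'D_v f x = 'D_v g x.
Proof. by move=> Uo Ux /(near_open Uo Ux); exact: near_eq_derive. Qed.

Lemma derive_dir_linear V W (f : V -> W) x a u v : differentiable f x ->
  'D_(a *: u + v) f x = a *: 'D_u f x + 'D_v f x.
Proof. by move=> df; rewrite !deriveE// linearP. Qed.

Lemma derive_compE V V' W (f : V -> V') (g : V' -> W) x v :
  differentiable f x -> differentiable g (f x) ->
  'D_v (g \o f) x = 'D_('D_v f x) g (f x).
Proof.
move=> df dg; rewrite !deriveE//; last exact: differentiable_comp.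
by rewrite diff_comp.
Qed.

Lemma differentiable_bigsum V W (I : finType) (f : I -> V -> W) x :
  (forall i, differentiable (f i) x) ->
  differentiable (fun z => \sum_i f i z) x.
Proof.
move=> df; have -> : (fun z => \sum_i f i z) = \sum_i f i.
  by apply/funext => z; rewrite fct_sumE.
by elim/big_ind : _ => // g h dg dh; exact: differentiableD.
Qed.

Lemma derive_bigsum V W n (f : 'I_n -> V -> W) x v :
  (forall i, differentiable (f i) x) ->
  'D_v (fun z => \sum_(i < n) f i z) x = \sum_(i < n) 'D_v (f i) x.
Proof.
move=> df; have -> : (fun z => \sum_(i < n) f i z) = \sum_(i < n) f i.
  by apply/funext => z; rewrite fct_sumE.
by rewrite derive_sum // => i; exact: diff_derivable.
Qed.

Lemma differentiable_prod V n (f : 'I_n -> V -> R) x :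
  (forall i, differentiable (f i) x) ->
  differentiable (fun z => \prod_(i < n) f i z) x.
Proof.
elim: n f => [|n IH] f df.
  under eq_fun do rewrite big_ord0.
  exact: differentiable_cst.
under eq_fun do rewrite big_ord_recl.
apply: differentiableM => //.
exact: (IH (fun i z => f (lift ord0 i) z)).
Qed.

Lemma differentiable_det V n (A : V -> 'M[R]_n) x :
  (forall i j, differentiable (fun z => A z i j) x) ->
  differentiable (fun z => \det (A z)) x.
Proof.
move=> dA; apply: differentiable_bigsum => s.
apply: (differentiableM (differentiable_cst _ _)).
by apply: differentiable_prod => i.
Qed.

Lemma differentiable_mxP V m n (A : V -> 'M[R]_(m, n)) x :
  differentiable A x <-> forall i j, differentiable (fun z => A z i j) x.
Proof.
split=> [dA i j|dA].
  exact: (differentiable_comp dA (differentiable_coord _ _ _)).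
have -> : A = fun z => \sum_(i < m) \sum_(j < n) A z i j *: delta_mx i j.
  by apply/funext => z; exact: matrix_sum_delta.
apply: differentiable_bigsum => i; apply: differentiable_bigsum => j.
exact: differentiableZl.
Qed.

Lemma derive_mxE V m n (A : V -> 'M[R]_(m, n)) x v i j : differentiable A x ->
  ('D_v A x) i j = 'D_v (fun z => A z i j) x.
Proof. by move=> dA; rewrite derive_mx ?mxE//; exact: diff_derivable. Qed.

(** Finite dimension: such a map is a combination of coordinate functions. *)
Lemma mx_linear_continuous W m n (f : {linear 'M[R]_(m, n) -> W}) :
  continuous f.
Proof.
have -> : f = (fun A => \sum_(i < m) \sum_(j < n) A i j *: f (delta_mx i j))
    :> (_ -> _).
  apply/funext => A; rewrite [in LHS](matrix_sum_delta A) linear_sum.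
  apply: eq_bigr => i _; rewrite linear_sum; apply: eq_bigr => j _.
  exact: linearZ.
move=> A; apply: differentiable_continuous.
apply: differentiable_bigsum => i; apply: differentiable_bigsum => j.
apply: differentiableZl; exact: differentiable_coord.
Qed.

Lemma differentiable_mx_linear V W m n (f : {linear 'M[R]_(m, n) -> W})
    (A : V -> 'M[R]_(m, n)) x :
  differentiable A x -> differentiable (fun z => f (A z)) x.
Proof.
move=> dA; apply: (differentiable_comp dA); apply: linear_differentiable.
exact: mx_linear_continuous.
Qed.

Lemma derive_mx_linear V W m n (f : {linear 'M[R]_(m, n) -> W})
    (A : V -> 'M[R]_(m, n)) x v :
  differentiable A x -> 'D_v (fun z => f (A z)) x = f ('D_v A x).
Proof.
have cf : continuous f by exact: mx_linear_continuous.
have df z : differentiable (f : _ -> _) z by exact: linear_differentiable.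
move=> dA; rewrite (@derive_compE _ _ _ A f)//.
by rewrite (deriveE _ (df _)) diff_lin.
Qed.

Lemma linear_rowE k (L : 'rV[R]_k -> R) u :
  (forall a u v, L (a *: u + v) = a * L u + L v) ->
  L u = \sum_(j < k) u 0 j * L (delta_mx 0 j).
Proof.
move=> lin; rewrite [in LHS](row_sum_delta u).
elim/big_rec2 : _ => [|j a b _ <-]; last by rewrite lin.
by have := lin (-1) 0 0; rewrite scaleN1r oppr0 addr0 mulN1r addNr.
Qed.

(** The Leibniz rule for a pairing that is linear in one argument and depends on
    the point.  All product rules below (for bilinear forms, Christoffel symbols
    and endomorphism fields along a map) are instances of this one, used once
    for each argument. It holds because L z is determined by its values on the
    standard basis. *)
Lemma derive_linear_family_scalar V k (U : set V) (L : V -> 'rV[R]_k -> R)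
    (A : V -> 'rV[R]_k) y :
  open U -> U y ->
  (forall z, U z -> forall a u v, L z (a *: u + v) = a * L z u + L z v) ->
  (forall a, differentiable (L ^~ a) y) -> differentiable A y ->
  differentiable (fun z => L z (A z)) y /\
  forall w, 'D_w (fun z => L z (A z)) y =
            'D_w (L ^~ (A y)) y + L y ('D_w A y).
Proof.
move=> Uo Uy lin dL dA.
have LE z u : U z -> L z u = \sum_(j < k) u 0 j * L z (delta_mx 0 j).
  by move=> Uz; apply: linear_rowE; exact: lin.
have dAj j : differentiable (fun z => A z 0 j) y by move/differentiable_mxP : dA.
have dterm j : differentiable (fun z => A z 0 j * L z (delta_mx 0 j)) y.
  exact: (differentiableM (dAj j) (dL _)).
split.
  apply: (@open_eq_differentiable _ _ U
    (fun z => \sum_(j < k) A z 0 j * L z (delta_mx 0 j))) => //.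
    by move=> z Uz; rewrite -LE.
  exact: differentiable_bigsum.
move=> w.
rewrite (@open_eq_derive _ _ U _
  (fun z => \sum_(j < k) A z 0 j * L z (delta_mx 0 j)))//; last first.
  by move=> z Uz; rewrite -LE.
rewrite [X in _ = X + _](@open_eq_derive _ _ U _
  (fun z => \sum_(j < k) A y 0 j * L z (delta_mx 0 j)))//; last first.
  by move=> z Uz; rewrite -LE.
rewrite derive_bigsum// derive_bigsum; last first.
  by move=> j; apply: (differentiableM (differentiable_cst _ _) (dL _)).
rewrite (LE _ _ Uy) -big_split; apply: eq_bigr => j _ /=.
rewrite (@deriveM _ _ (fun z => A z 0 j) (L ^~ (delta_mx 0 j)));
  [|exact: diff_derivable..].
rewrite (@deriveM _ _ (cst (A y 0 j)) (L ^~ (delta_mx 0 j)));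
  [|exact: diff_derivable..].
rewrite derive_cst scaler0 addr0; congr (_ + _).
by rewrite -derive_mxE// [RHS]mulrC.
Qed.

Lemma derive_linear_family V k q (U : set V) (L : V -> 'rV[R]_k -> 'rV[R]_q)
    (A : V -> 'rV[R]_k) y :
  open U -> U y ->
  (forall z, U z -> forall a u v, L z (a *: u + v) = a *: L z u + L z v) ->
  (forall a, differentiable (L ^~ a) y) -> differentiable A y ->
  differentiable (fun z => L z (A z)) y /\
  forall w, 'D_w (fun z => L z (A z)) y =
            'D_w (L ^~ (A y)) y + L y ('D_w A y).
Proof.
move=> Uo Uy lin dL dA.
have H j := @derive_linear_family_scalar V k U (fun z a => L z a 0 j) A y Uo Uy.
have {}H j : differentiable (fun z => L z (A z) 0 j) y /\
  forall w, 'D_w (fun z => L z (A z) 0 j) y =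
            'D_w (fun z => L z (A y) 0 j) y + L y ('D_w A y) 0 j.
  apply: H => // [z Uz a u v|a]; first by rewrite lin// !mxE.
  by have /differentiable_mxP := dL a.
have dLA : differentiable (fun z => L z (A z)) y.
  by apply/differentiable_mxP => i j; rewrite ord1; case: (H j).
split=> // w; apply/rowP => j.
by rewrite mxE !derive_mxE//; case: (H j).
Qed.

Lemma differentiable_mulmx (V : normedModType R) m n p
    (A : V -> 'M[R]_(m, n)) (B : V -> 'M[R]_(n, p)) x :
  differentiable A x -> differentiable B x ->
  differentiable (fun z => A z *m B z) x.
Proof.
move=> /differentiable_mxP dA /differentiable_mxP dB.
apply/differentiable_mxP => i k.
under eq_fun do rewrite mxE.
by apply: differentiable_bigsum => j; exact: differentiableM.
Qed.

(** By Cramer's rule the entries of the inverse are rational functions of the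
    entries of the matrix. *)
Lemma differentiable_invmx V (U : set V) n (A : V -> 'M[R]_n) x :
  open U -> U x -> (forall z, U z -> A z \in unitmx) ->
  differentiable A x -> differentiable (fun z => invmx (A z)) x.
Proof.
move=> Uo Ux Au /differentiable_mxP dA; apply/differentiable_mxP => i j.
apply: (@open_eq_differentiable _ _ U
  (fun z => (\det (A z))^-1 * ((-1) ^+ (j + i) * \det (row' j (col' i (A z)))))) => //.
  by move=> z Uz; rewrite /invmx Au// !mxE.
apply: differentiableM.
  apply: differentiableV; first exact: differentiable_det.
  by have := Au _ Ux; rewrite unitmxE unitfE.
apply: (differentiableM (differentiable_cst _ _)).
apply: differentiable_det => k l.
by under eq_fun do rewrite !mxE; exact: dA.
Qed.

End Calculus.

(** * Symmetry of second derivatives *)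

Section Schwarz.
Context {R : realType}.
Implicit Types V W : normedModType R.

Lemma is_derive_line V W (f : V -> W) x v (s : R) : differentiable f (x + s *: v) ->
  is_derive s 1 (fun s => f (x + s *: v)) ('D_v f (x + s *: v)).
Proof.
move=> df.
have E :
  (fun h : R => h^-1 *: (f (x + (h *: 1 + s) *: v) - f (x + s *: v))) =
  (fun h => h^-1 *: (f (h *: v + (x + s *: v)) - f (x + s *: v))).
  by apply/funext => h; rewrite [h *: 1]mulr1 scalerDl addrCA.
apply: DeriveDef; first by rewrite /derivable E; exact: diff_derivable.
by rewrite /derive E.
Qed.

(** The Young form of the second-order expansion: it suffices that 'D_v f be
    differentiable at the one point x.  The mean value theorem along v reduces
    the second difference to an increment of 'D_v f, whose linear
    approximation at x is accurate up to e / C times the distance to x. *)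
Lemma second_difference V (U : set V) (f : V -> R) x v w :
  open U -> U x -> (forall z, U z -> differentiable f z) ->
  differentiable ('D_v f) x ->
  forall e, 0 < e -> \forall t \near (0 : R)^'+,
  `|(f (x + t *: w + t *: v) - f (x + t *: v) - f (x + t *: w) + f x)
    - t ^+ 2 * 'D_w ('D_v f) x| <= e * t ^+ 2.
Proof.
move=> Uo Ux df dg e e0; set g := 'D_v f.
(* The two points where 'D_v f is approximated lie at distances at most
   t * (|v| + |w|) and t * |v| from x; the 1 makes C positive. *)
pose C := 2 * `|v| + `|w| + 1.
have C0 : 0 < C by rewrite /C; have := normr_ge0 v; have := normr_ge0 w; lra.
have eC : 0 < e / C by exact: divr_gt0.
have /nbhs_ballP [d /= d0 dP] : \forall h \near (0 : V),
   `|g (x + h) - g x - 'd g x h| <= e / C * `|h|.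
  have /eqaddoP/(_ _ eC) := diff_locally dg.
  by apply: filterS => h /=; rewrite !fctE /= opprD addrA [h + x]addrC.
have /nbhs_ballP [r /= r0 rP] := open_nbhs_nbhs (conj Uo Ux).
near=> t.
have t0 : 0 < t by near: t; exact: nbhs_right_gt.
have tC : t * C < Num.min d r.
  rewrite -ltr_pdivlMr//; near: t; apply: nbhs_right_lt.
  by rewrite divr_gt0// lt_min d0 r0.
have [tCd tCr] : t * C < d /\ t * C < r by apply/andP; rewrite -lt_min.
have small s b : 0 <= s <= t -> 0 <= b <= t ->
    `|b *: w + s *: v| <= t * (`|v| + `|w|).
  move=> /andP[s0 st] /andP[b0 bt]; apply: le_trans (ler_normD _ _) _.
  by rewrite !normrZ !ger0_norm// addrC mulrDr lerD// ler_wpM2r.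
have smallC s b : 0 <= s <= t -> 0 <= b <= t -> `|b *: w + s *: v| < t * C.
  move=> hs hb; apply: le_lt_trans (small _ _ hs hb) _; rewrite ltr_pM2l// /C.
  by have := normr_ge0 v; lra.
have inU s b : 0 <= s <= t -> 0 <= b <= t -> U (x + b *: w + s *: v).
  move=> hs hb; apply: rP; rewrite -ball_normE /ball_/= -(addrA x) opprD addNKr normrN.
  by apply: lt_trans tCr; exact: smallC.
have gP s b : 0 <= s <= t -> 0 <= b <= t ->
  `|g (x + b *: w + s *: v) - g x - 'd g x (b *: w + s *: v)|
     <= e / C * `|b *: w + s *: v|.
  move=> hs hb; rewrite -(addrA x); apply: dP; rewrite -ball_normE /ball_/= sub0r normrN.
  by apply: lt_trans tCd; exact: smallC.
have tt : 0 <= t <= t by rewrite ltW /=.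
have z0 : (0 : R) <= 0 <= t by rewrite lexx ltW.
have dline b s : 0 <= b <= t -> 0 <= s <= t ->
    is_derive s 1 (fun s => f (x + b *: w + s *: v)) (g (x + b *: w + s *: v)).
  by move=> hb hs; apply: is_derive_line; apply: df; exact: inU.
pose phi s := f (x + t *: w + s *: v) - f (x + 0 *: w + s *: v).
have [||s /[!in_itv] /= hs] := @MVT R phi
  (fun s => g (x + t *: w + s *: v) - g (x + 0 *: w + s *: v)) 0 t t0.
- move=> s; rewrite in_itv /= => /andP[/ltW s0 /ltW st].
  by apply: is_deriveB; apply: dline; rewrite ?s0.
- apply: derivable_within_continuous => s; rewrite in_itv /= => hs.
  by apply: derivableB; apply: ex_derive; exact: dline.
have {}hs : 0 <= s <= t by case/andP: hs => /ltW-> /ltW->.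
rewrite subr0 /phi !scale0r !addr0 => dphi.
have H1 := gP _ _ hs tt; have H2 := gP _ _ hs z0.
have n1 := small _ _ hs tt; have n2 := small _ _ hs z0.
move: H2 n2; rewrite scale0r addr0 add0r => H2 n2.
rewrite linearD linearZ /= -(deriveE _ dg) in H1.
set a := g (x + t *: w + s *: v) in dphi H1; set b := g (x + s *: v) in dphi H2.
have -> : f (x + t *: w + t *: v) - f (x + t *: v) - f (x + t *: w) + f x
   = (a - b) * t by rewrite -dphi; lra.
set D := 'D_w g x in H1 *.
have -> : (a - b) * t - t ^+ 2 * D = t * ((a - g x - (t * D + 'd g x (s *: v))) -
   (b - g x - 'd g x (s *: v))) by ring.
rewrite normrM gtr0_norm// expr2 mulrCA ler_pM2l//.
apply: le_trans (ler_normB _ _) _; apply: le_trans (lerD H1 H2) _.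
rewrite -mulrDr mulrAC ler_pdivrMr// -mulrA ler_pM2l//.
have n3 : `|s *: v| <= t * `|v|.
  by case/andP: hs => s0 st; rewrite normrZ ger0_norm// ler_wpM2r.
by rewrite /C; nra.
Unshelve. all: by end_near. Qed.

Lemma dist_le_of_common_approx (e s q a b c D1 D2 : R) :
  0 < s -> `|q - a - b + c - s * D1| <= e / 2 * s ->
  `|q - b - a + c - s * D2| <= e / 2 * s -> `|D1 - D2| <= e.
Proof.
move=> s0 H K; rewrite -(ler_pM2l s0) -{1}(gtr0_norm s0) -normrM mulrBr.
move: H; rewrite ler_norml => /andP[h1 h2].
move: K; rewrite ler_norml => /andP[h3 h4].
by rewrite ler_norml; apply/andP; split; lra.
Qed.

(** The second difference is symmetric in v and w, and both mixed derivatives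
    are its leading coefficient in t ^+ 2. *)
Lemma derive_comm_scalar V (U : set V) (f : V -> R) x v w :
  open U -> U x -> (forall z, U z -> differentiable f z) ->
  differentiable ('D_v f) x -> differentiable ('D_w f) x ->
  'D_w ('D_v f) x = 'D_v ('D_w f) x.
Proof.
move=> Uo Ux df dv dw; apply/eqP; rewrite -subr_eq0 -normr_le0.
apply/ler_addgt0Pr => /= e; rewrite add0r => e0; have e2 : 0 < e / 2 by lra.
have H := second_difference w Uo Ux df dv e2.
have K := second_difference v Uo Ux df dw e2.
have [t [/= t0 [{}H {}K]]] := filter_ex (filterI (nbhs_right_gt (0 : R)) (filterI H K)).
have t2 : 0 < t ^+ 2 by rewrite exprn_gt0.
rewrite [x + _ + t *: w]addrAC in K.
exact: dist_le_of_common_approx t2 H K.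
Qed.

Lemma derive_comm V n (U : set V) (f : V -> 'rV[R]_n) x v w :
  open U -> U x -> (forall z, U z -> differentiable f z) ->
  differentiable ('D_v f) x -> differentiable ('D_w f) x ->
  'D_w ('D_v f) x = 'D_v ('D_w f) x.
Proof.
move=> Uo Ux df dv dw; apply/rowP => j.
have E u z : U z -> ('D_u f z) 0 j = 'D_u (fun z => f z 0 j) z.
  by move=> Uz; exact: (derive_mxE _ _ _ (df _ Uz)).
have dE u : differentiable ('D_u f) x -> differentiable ('D_u (fun z => f z 0 j)) x.
  move=> /differentiable_mxP/(_ 0 j).
  exact: (open_eq_differentiable Uo Ux (E u)).
have EE u t : differentiable ('D_u f) x ->
    ('D_t ('D_u f) x) 0 j = 'D_t ('D_u (fun z => f z 0 j)) x.
  move=> du; apply: etrans (derive_mxE t 0 j du) _.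
  exact: (open_eq_derive t Uo Ux (E u)).
apply: etrans (EE v w dv) _; apply: etrans _ (esym (EE w v dw)).
apply: (derive_comm_scalar Uo Ux); [|exact: dE..].
by move=> z /df/differentiable_mxP.
Qed.

End Schwarz.

Section TwiceDifferentiable.
Context {R : realType}.

Definition twice_diff_on (V W : normedModType R) (U : set V) (f : V -> W) : Prop :=
  (forall x, U x -> differentiable f x) /\
  (forall v x, U x -> differentiable ('D_v f) x).

Lemma twice_diff_id (V : normedModType R) (D : set V) : twice_diff_on D (id : V -> V).
Proof.
split=> [x _|v x _]; first exact: ex_diff.
have -> : 'D_v (id : V -> V) = cst v by apply/funext => z; exact: derive_id.
exact: differentiable_cst.
Qed.

Lemma twice_diff_eq (V W : normedModType R) (D : set V) (f g : V -> W) :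
  open D -> (forall z, D z -> f z = g z) -> twice_diff_on D f -> twice_diff_on D g.
Proof.
move=> Do E [f1 f2]; split=> [z Dz|v z Dz].
  exact: (open_eq_differentiable Do Dz E (f1 z Dz)).
apply: (open_eq_differentiable Do Dz _ (f2 v z Dz)) => t Dt.
exact: (open_eq_derive v Do Dt E).
Qed.

Lemma twice_diff_mx_linear (V W : normedModType R) m n (U : set V)
    (f : {linear 'M[R]_(m, n) -> W}) (A : V -> 'M[R]_(m, n)) :
  open U -> twice_diff_on U A -> twice_diff_on U (fun z => f (A z)).
Proof.
move=> Uo [A1 A2]; split=> [z Uz|v z Uz].
  have H := differentiable_mx_linear f (A1 _ Uz); exact: H.
apply: (open_eq_differentiable Uo Uz (f := fun z => f ('D_v A z))).
  by move=> t Ut; have H := derive_mx_linear f v (A1 _ Ut); exact: esym H.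
have H := differentiable_mx_linear f (A2 v _ Uz); exact: H.
Qed.

Lemma smooth_derive m (W : normedModType R) (U : set 'rV[R]_m)
  (f : 'rV[R]_m -> W) v : smooth_on U f -> smooth_on U ('D_v f).
Proof. by move=> fs k; have [_] := fs k.+1; exact. Qed.

Lemma smooth_twice_diff m (W : normedModType R) (U : set 'rV[R]_m)
  (f : 'rV[R]_m -> W) : smooth_on U f -> twice_diff_on U f.
Proof.
by move=> fs; have [f1 f2] := fs 2%N; split=> // v; have [f21 _] := f2 v.
Qed.

End TwiceDifferentiable.

(** * Riemannian metrics and their Christoffel symbols *)

Section BilinearForms.
Context {R : realType}.

Lemma eq_opp0 (a : R) : a = - a -> a = 0.
Proof. by move=> ?; lra. Qed.

Variables (n : nat) (A : 'M[R]_n).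
Implicit Types X Y Z : 'rV[R]_n.

Lemma bform_linl a X X' Y :
  bform A (a *: X + X') Y = a * bform A X Y + bform A X' Y.
Proof. by rewrite /bform !mulmxDl -!scalemxAl !mxE. Qed.

Lemma bform_linr a X Y Y' :
  bform A X (a *: Y + Y') = a * bform A X Y + bform A X Y'.
Proof. by rewrite /bform linearP /= mulmxDr -scalemxAr !mxE. Qed.

Lemma bform0l Y : bform A 0 Y = 0.
Proof. by rewrite /bform !mul0mx mxE. Qed.

Lemma bform0r X : bform A X 0 = 0.
Proof. by rewrite /bform trmx0 mulmx0 mxE. Qed.

Lemma bformDl X X' Y : bform A (X + X') Y = bform A X Y + bform A X' Y.
Proof. by have := bform_linl 1 X X' Y; rewrite scale1r mul1r. Qed.

Lemma bformDr X Y Y' : bform A X (Y + Y') = bform A X Y + bform A X Y'.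
Proof. by have := bform_linr 1 X Y Y'; rewrite scale1r mul1r. Qed.

Lemma bformNl X Y : bform A (- X) Y = - bform A X Y.
Proof. by rewrite -[- X]addr0 -scaleN1r bform_linl bform0l addr0 mulN1r. Qed.

Lemma bformNr X Y : bform A X (- Y) = - bform A X Y.
Proof. by rewrite -[- Y]addr0 -scaleN1r bform_linr bform0r addr0 mulN1r. Qed.

Lemma bformBl X X' Y : bform A (X - X') Y = bform A X Y - bform A X' Y.
Proof. by rewrite bformDl bformNl. Qed.

Lemma bformBr X Y Y' : bform A X (Y - Y') = bform A X Y - bform A X Y'.
Proof. by rewrite bformDr bformNr. Qed.

Lemma bform_deltar X l : bform A X (delta_mx 0 l) = (X *m A) 0 l.
Proof. by rewrite /bform trmx_delta -colE mxE. Qed.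

Lemma bform_delta i j : bform A (delta_mx 0 i) (delta_mx 0 j) = A i j.
Proof. by rewrite bform_deltar -rowE mxE. Qed.

Lemma bform_sym X Y : A^T = A -> bform A X Y = bform A Y X.
Proof.
move=> As; have -> : bform A X Y = (X *m A *m Y^T)^T 0 0 by rewrite mxE.
by rewrite !trmx_mul trmxK As mulmxA.
Qed.

Lemma bform_inj X Y : A \in unitmx ->
  (forall Z, bform A X Z = bform A Y Z) -> X = Y.
Proof.
move=> Au H; rewrite -[X](mulmxK Au) -[Y](mulmxK Au); congr (_ *m _).
by apply/rowP => l; rewrite -!bform_deltar.
Qed.

Lemma posdef_unitmx :
  (forall X, X != 0 -> 0 < bform A X X) -> A \in unitmx.
Proof.
move=> Apos; rewrite -row_free_unit -kermx_eq0; apply/eqP/row_matrixP => i.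
rewrite row0; apply/eqP/negPn/negP => /Apos.
rewrite /bform (_ : row i (kermx A) *m A = 0) ?mul0mx ?mxE ?ltxx//.
by apply/sub_kermxP; exact: row_sub.
Qed.

Lemma bform_twice_diff (V : normedModType R) (U : set V) (B : V -> 'M[R]_n) X Y :
  open U -> twice_diff_on U B -> twice_diff_on U (fun z => bform (B z) X Y).
Proof.
have lin : linear (fun C : 'M[R]_n => bform C X Y : R^o).
  move=> a C C'; rewrite /bform mulmxDr mulmxDl -scalemxAr -scalemxAl.
  by rewrite [LHS]mxE [X in X + _]mxE.
pose fM := GRing.isLinear.Build _ _ _ _ _ lin.
pose fL : {linear 'M[R]_n -> R^o} := HB.pack (fun C : 'M[R]_n => bform C X Y : R^o) fM.
move=> Uo BC; have H := twice_diff_mx_linear fL Uo BC; exact: H.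
Qed.

End BilinearForms.

Section Metric.
Context {R : realType}.

(** Regularity is stated for the functions g(X, Y), which are what can be
    differentiated directly for an induced metric; two derivatives make the
    Christoffel symbols differentiable. *)
Record metric_on (N : nat) (U : set 'rV[R]_N) (G : 'rV[R]_N -> 'M[R]_N) : Prop := {
  metric_open : open U;
  metric_sym : forall x, U x -> (G x)^T = G x;
  metric_pos : forall x, U x -> forall X, X != 0 -> 0 < bform (G x) X X;
  metric_twice_diff : forall X Y, twice_diff_on U (fun z => bform (G z) X Y) }.

Definition dmetric (N : nat) (G : 'rV[R]_N -> 'M[R]_N) (X Y Z x : 'rV[R]_N) : R :=
  'D_X (fun z => bform (G z) Y Z) x.

Variables (N : nat) (U : set 'rV[R]_N) (G : 'rV[R]_N -> 'M[R]_N).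
Hypothesis gU : metric_on U G.
Implicit Types X Y Z : 'rV[R]_N.

Local Notation dg := (dmetric G).
Local Notation Gam := (christoffel G).

Lemma metric_unit x : U x -> G x \in unitmx.
Proof. by move=> Ux; apply: posdef_unitmx; exact: metric_pos gU _ Ux. Qed.

Lemma metricC x X Y : U x -> bform (G x) X Y = bform (G x) Y X.
Proof. by move=> Ux; apply: bform_sym; exact: metric_sym gU _ Ux. Qed.

Lemma metric_inj x X Y : U x ->
  (forall Z, bform (G x) X Z = bform (G x) Y Z) -> X = Y.
Proof. by move=> Ux; apply: bform_inj; exact: metric_unit. Qed.

Lemma metric_differentiable x X Y : U x ->
  differentiable (fun z => bform (G z) X Y) x.
Proof. by case: (metric_twice_diff gU X Y) => H _ /H. Qed.

Lemma dmetricC x X Y Z : U x -> dg X Y Z x = dg X Z Y x.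
Proof.
move=> Ux; apply: (open_eq_derive _ (metric_open gU) Ux) => z Uz.
exact: metricC.
Qed.

Lemma dmetric_linr x a X Y Z Z' : U x ->
  dg X Y (a *: Z + Z') x = a * dg X Y Z x + dg X Y Z' x.
Proof.
move=> Ux; rewrite /dmetric; have dd T : derivable (fun z => bform (G z) Y T) x X.
  by apply: diff_derivable; exact: metric_differentiable.
under eq_fun do rewrite bform_linr.
rewrite (@deriveD _ _ _ (a \*: (fun z => bform (G z) Y Z)) _ _ _ _ (dd Z')).
  by rewrite deriveZ.
exact: derivableZ.
Qed.

Lemma dmetric_linl x a X Y Y' Z : U x ->
  dg X (a *: Y + Y') Z x = a * dg X Y Z x + dg X Y' Z x.
Proof.
move=> Ux; rewrite (dmetricC X _ Z Ux) (dmetric_linr a X Z _ _ Ux).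
by rewrite (dmetricC X Z Y Ux) (dmetricC X Z Y' Ux).
Qed.

Lemma dmetric_lin x a X X' Y Z : U x ->
  dg (a *: X + X') Y Z x = a * dg X Y Z x + dg X' Y Z x.
Proof. by move=> Ux; rewrite /dmetric derive_dir_linear//; exact: metric_differentiable. Qed.

(** The inverse matrix in the definition of Christoffel symbols is removed by
    pairing with Z; both sides are linear in Z, which reduces to the
    coordinate vectors. *)
Lemma koszul x X Y Z : U x ->
  bform (G x) (Gam x X Y) Z = 2^-1 * (dg X Y Z x + dg Y X Z x - dg Z X Y x).
Proof.
move=> Ux; rewrite /bform /christoffel mulmxKV ?metric_unit// mxE.
rewrite [RHS](linear_rowE
  (L := fun Z => 2^-1 * (dg X Y Z x + dg Y X Z x - dg Z X Y x))).
  by apply: eq_bigr => l _; rewrite !mxE mulrC.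
move=> a Z1 Z2; rewrite (dmetric_linr a X Y _ _ Ux) (dmetric_linr a Y X _ _ Ux).
by rewrite (dmetric_lin a _ _ X Y Ux); ring.
Qed.

(** The Levi-Civita connection is torsion-free. *)
Lemma christoffelC x X Y : U x -> Gam x X Y = Gam x Y X.
Proof.
move=> Ux; apply: (metric_inj Ux) => Z; rewrite (koszul X Y Z Ux) (koszul Y X Z Ux).
by rewrite (dmetricC Z X Y Ux); ring.
Qed.

Lemma christoffel_linl x a X X' Y : U x ->
  Gam x (a *: X + X') Y = a *: Gam x X Y + Gam x X' Y.
Proof.
move=> Ux; apply: (metric_inj Ux) => Z; rewrite bform_linl.
rewrite (koszul _ Y Z Ux) (koszul X Y Z Ux) (koszul X' Y Z Ux).
rewrite (dmetric_lin a _ _ Y Z Ux) (dmetric_linl a Y _ _ Z Ux).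
by rewrite (dmetric_linl a Z _ _ Y Ux); ring.
Qed.

Lemma christoffel_linr x a X Y Y' : U x ->
  Gam x X (a *: Y + Y') = a *: Gam x X Y + Gam x X Y'.
Proof.
move=> Ux; rewrite (christoffelC X _ Ux) (christoffel_linl a _ _ X Ux).
by rewrite (christoffelC Y X Ux) (christoffelC Y' X Ux).
Qed.

Lemma christoffel_differentiable x X Y : U x ->
  differentiable (fun z => Gam z X Y) x.
Proof.
move=> Ux; have Uo := metric_open gU.
apply: differentiable_mulmx; last first.
  apply: (differentiable_invmx Uo Ux); first by move=> z; exact: metric_unit.
  apply/differentiable_mxP => i j.
  under eq_fun do rewrite -bform_delta.
  exact: metric_differentiable.
apply/differentiable_mxP => i l.
under eq_fun do rewrite mxE.
apply: (differentiableM (differentiable_cst _ _)).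
have D v Y1 Z1 : differentiable (fun z => dg v Y1 Z1 z) x.
  by case: (metric_twice_diff gU Y1 Z1) => _; exact.
exact: differentiableB (differentiableD (D _ _ _) (D _ _ _)) (D _ _ _).
Qed.

(** The Levi-Civita connection is metric. *)
Lemma christoffel_metric x X Y Z : U x ->
  dg X Y Z x = bform (G x) (Gam x X Y) Z + bform (G x) Y (Gam x X Z).
Proof.
move=> Ux; rewrite (metricC Y _ Ux) (koszul X Y Z Ux) (koszul X Z Y Ux).
by rewrite (dmetricC X Z Y Ux) (dmetricC Y X Z Ux) (dmetricC Z X Y Ux); field.
Qed.

Lemma nabla_cst X Z : nabla G X (cst Z) = fun z => Gam z X Z.
Proof. by apply/funext => z; rewrite /nabla derive_cst add0r. Qed.

Lemma curvatureE x X Y Z : curvature G x X Y Z =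
  ('D_X (fun z => Gam z Y Z) x + Gam x X (Gam x Y Z)) -
  ('D_Y (fun z => Gam z X Z) x + Gam x Y (Gam x X Z)).
Proof. by rewrite /curvature !nabla_cst /nabla. Qed.

End Metric.

(** * Covariant derivative along a map *)

Section Along.
Context {R : realType}.
Variables (m N : nat) (U : set 'rV[R]_N) (G : 'rV[R]_N -> 'M[R]_N).
Variables (D : set 'rV[R]_m) (F : 'rV[R]_m -> 'rV[R]_N).
Hypotheses (gU : metric_on U G) (Do : open D) (FD : forall y, D y -> U (F y)).
Hypothesis F2 : twice_diff_on D F.

Local Notation Gam := (christoffel G).
Local Notation nab := (nabla_along G F).
Local Notation push X y := ((X : 'rV[R]_m) *m 'J F y).

Let Fdiff y : D y -> differentiable F y. Proof. by case: F2 => H _ /H. Qed.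
Let Fdiff2 v y : D y -> differentiable ('D_v F) y.
Proof. by case: F2 => _ H; exact: H. Qed.

Lemma pushE X y : D y -> push X y = 'D_X F y.
Proof. by move=> Dy; rewrite deriveEjacobian//; exact: Fdiff. Qed.

Lemma push_differentiable X y : D y -> differentiable (fun z => push X z) y.
Proof.
move=> Dy; apply: (open_eq_differentiable Do Dy (f := 'D_X F)); last exact: Fdiff2.
by move=> z Dz; rewrite pushE.
Qed.

Lemma derive_push X Y y : D y ->
  'D_X (fun z => push Y z) y = 'D_X ('D_Y F) y.
Proof. by move=> Dy; apply: (open_eq_derive _ Do Dy) => z Dz; rewrite pushE. Qed.

(** Both sides are second derivatives of F. *)
Lemma derive_pushC X Y y : D y ->
  'D_X (fun z => push Y z) y = 'D_Y (fun z => push X z) y.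
Proof.
move=> Dy; apply: etrans (derive_push X Y Dy) _.
apply: etrans _ (esym (derive_push Y X Dy)).
by apply: (derive_comm Do Dy Fdiff); exact: Fdiff2.
Qed.

Lemma christoffel_along (A B : 'rV[R]_m -> 'rV[R]_N) y : D y ->
  differentiable A y -> differentiable B y ->
  differentiable (fun z => Gam (F z) (A z) (B z)) y /\
  forall w, 'D_w (fun z => Gam (F z) (A z) (B z)) y =
    'D_(push w y) (fun x => Gam x (A y) (B y)) (F y)
    + Gam (F y) ('D_w A y) (B y) + Gam (F y) (A y) ('D_w B y).
Proof.
move=> Dy dA dB.
have lin1 b z : D z -> forall a u v,
    Gam (F z) (a *: u + v) b = a *: Gam (F z) u b + Gam (F z) v b.
  by move=> Dz a u v; exact: (christoffel_linl gU a u v b (FD Dz)).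
have lin2 z : D z -> forall a u v,
    Gam (F z) (A z) (a *: u + v) = a *: Gam (F z) (A z) u + Gam (F z) (A z) v.
  by move=> Dz a u v; exact: (christoffel_linr gU a (A z) u v (FD Dz)).
have dG a b : differentiable (fun x => Gam x a b) (F y).
  exact: (christoffel_differentiable gU _ _ (FD Dy)).
have dGF a b : differentiable (fun z => Gam (F z) a b) y.
  exact: (differentiable_comp (Fdiff Dy) (dG a b)).
have d1 b : differentiable (fun z => Gam (F z) (A z) b) y.
  by have [] := derive_linear_family Do Dy (lin1 b) (dGF ^~ b) dA.
have [_ e1] := derive_linear_family Do Dy (lin1 (B y)) (dGF ^~ (B y)) dA.
have [d2 e2] := derive_linear_family Do Dy lin2 d1 dB.
split=> [|w]; first exact: d2.
have e3 : 'D_w (fun z => Gam (F z) (A y) (B y)) y =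
    'D_(push w y) (fun x => Gam x (A y) (B y)) (F y).
  by rewrite (pushE w Dy); exact: (derive_compE w (Fdiff Dy) (dG (A y) (B y))).
exact: (etrans (e2 w) (congr1 (+%R^~ _)
  (etrans (e1 w) (congr1 (+%R^~ _) e3)))).
Qed.

Lemma nabla_along_differentiable X V y : twice_diff_on D V -> D y ->
  differentiable (nab X V) y.
Proof.
move=> [V1 V2] Dy; apply: differentiableD; first exact: V2.
by have [] := christoffel_along Dy (push_differentiable X Dy) (V1 _ Dy).
Qed.

Lemma nabla_alongD X A B y : D y -> differentiable A y -> differentiable B y ->
  nab X (fun z => A z + B z) y = nab X A y + nab X B y.
Proof.
move=> Dy dA dB; have e := deriveD (diff_derivable (v := X) dA) (diff_derivable (v := X) dB).
have := christoffel_linr gU 1 (push X y) (A y) (B y) (FD Dy).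
rewrite !scale1r => e'.
exact: etrans (congr2 +%R e e') (addrACA _ _ _ _).
Qed.

Lemma nabla_along_metric X A B y : D y ->
  differentiable A y -> differentiable B y ->
  differentiable (fun z => bform (G (F z)) (A z) (B z)) y /\
  'D_X (fun z => bform (G (F z)) (A z) (B z)) y =
    bform (G (F y)) (nab X A y) (B y) + bform (G (F y)) (A y) (nab X B y).
Proof.
move=> Dy dA dB.
have dG a b : differentiable (fun x => bform (G x) a b) (F y).
  exact: (metric_differentiable gU _ _ (FD Dy)).
have dGF a b : differentiable (fun z => bform (G (F z)) a b) y.
  exact: (differentiable_comp (Fdiff Dy) (dG a b)).
have lin1 b z : D z -> forall a u v,
    bform (G (F z)) (a *: u + v) b = a * bform (G (F z)) u b + bform (G (F z)) v b.
  by move=> _ a u v; exact: bform_linl.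
have lin2 z : D z -> forall a u v,
    bform (G (F z)) (A z) (a *: u + v) =
    a * bform (G (F z)) (A z) u + bform (G (F z)) (A z) v.
  by move=> _ a u v; exact: bform_linr.
have [|d1 e1] := derive_linear_family_scalar Do Dy (lin1 (B y)) _ dA; first by move=> a; exact: dGF.
have [|d2 e2] := derive_linear_family_scalar Do Dy lin2 _ dB.
  by move=> b; have [] := derive_linear_family_scalar Do Dy (lin1 b) (dGF ^~ b) dA.
split=> //; apply: etrans (e2 X) _.
apply: etrans (congr1 (+%R^~ _) (e1 X)) _ => /=.
have -> : 'D_X (fun z => bform (G (F z)) (A y) (B y)) y =
    dmetric G (push X y) (A y) (B y) (F y).
  by rewrite pushE//; exact: (derive_compE X (Fdiff Dy) (dG _ _)).
rewrite (christoffel_metric gU _ _ _ (FD Dy)) /nabla_along bformDl bformDr.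
ring.
Qed.

(** Torsion-freeness along F; it makes the second fundamental form symmetric. *)
Lemma nabla_along_pushC X Y y : D y ->
  nab X (fun z => push Y z) y = nab Y (fun z => push X z) y.
Proof.
move=> Dy; rewrite /nabla_along (derive_pushC X Y Dy).
by rewrite (christoffelC gU (push X y) (push Y y) (FD Dy)).
Qed.

Lemma ricci_identity_cancel (d x1 x2 c p q s t : 'rV[R]_N) :
  d + (x1 + c + p) + (q + s) - (d + (x2 + c + q) + (p + t)) = x1 + s - (x2 + t).
Proof. by apply/rowP => j; rewrite !mxE; ring. Qed.

(** Ricci identity along a map.  The curvature is defined on constant
    vector fields of the target; the statement for arbitrary fields along F
    contains its tensoriality. *)
Lemma curvature_along W X V y : twice_diff_on D V -> D y ->
  nab W (nab X V) y - nab X (nab W V) y =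
  curvature G (F y) (push W y) (push X y) (V y).
Proof.
move=> [V1 V2] Dy.
have dpush X' := push_differentiable X' Dy.
have expand W' X' : nab W' (nab X' V) y =
   'D_W' ('D_X' V) y +
     ('D_(push W' y) (fun x => Gam x (push X' y) (V y)) (F y)
       + Gam (F y) ('D_W' (fun z => push X' z) y) (V y)
       + Gam (F y) (push X' y) ('D_W' V y))
   + (Gam (F y) (push W' y) ('D_X' V y)
     + Gam (F y) (push W' y) (Gam (F y) (push X' y) (V y))).
  have [dC eC] := christoffel_along Dy (dpush X') (V1 _ Dy).
  rewrite {1}/nabla_along; congr (_ + _).
    apply: etrans (deriveD _ _) _; [exact: diff_derivable (V2 _ _ Dy)|exact: diff_derivable dC|].
    by congr (_ + _); exact: eC.
  have := christoffel_linr gU 1 (push W' y) ('D_X' V y) (Gam (F y) (push X' y) (V y)) (FD Dy).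
  by rewrite !scale1r.
rewrite (expand W X) (expand X W) curvatureE.
have -> : 'D_W ('D_X V) y = 'D_X ('D_W V) y.
  by apply: (derive_comm Do Dy V1); exact: V2.
rewrite (derive_pushC W X Dy).
exact: ricci_identity_cancel.
Qed.

Variable J : 'rV[R]_N -> 'M[R]_N.
Hypothesis Jdiff : forall x, U x -> differentiable J x.
Hypothesis Jpar : forall x, U x -> forall X Y,
  nabla G X (fun z => Y *m J z) x - nabla G X (cst Y) x *m J x = 0.

(** J is parallel, so it commutes with the derivative of any field along F. *)
Lemma nabla_along_J X V y : D y -> differentiable V y ->
  differentiable (fun z => V z *m J (F z)) y /\
  nab X (fun z => V z *m J (F z)) y = nab X V y *m J (F y).
Proof.
move=> Dy dV.
have dJ (Y : 'rV[R]_N) : differentiable (fun x => Y *m J x) (F y).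
  exact: (differentiable_mulmx (differentiable_cst _ _) (Jdiff (FD Dy))).
have lin z : D z -> forall a (u v : 'rV[R]_N),
    (a *: u + v) *m J (F z) = a *: (u *m J (F z)) + v *m J (F z).
  by move=> _ a u v; rewrite mulmxDl scalemxAl.
have [|d1 e1] := derive_linear_family (L := fun z a => a *m J (F z)) Do Dy lin _ dV.
  by move=> a; exact: (differentiable_comp (Fdiff Dy) (dJ a)).
split; first exact: d1.
have e2 : 'D_X (fun z => V y *m J (F z)) y = 'D_(push X y) (fun x => V y *m J x) (F y).
  by rewrite (pushE X Dy); exact: (derive_compE X (Fdiff Dy) (dJ (V y))).
have e3 : 'D_(push X y) (fun x => V y *m J x) (F y)
    + Gam (F y) (push X y) (V y *m J (F y)) = Gam (F y) (push X y) (V y) *m J (F y).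
  by have /eqP := Jpar (FD Dy) (push X y) (V y); rewrite nabla_cst subr_eq0 => /eqP.
rewrite /nabla_along mulmxDl -e3 -e2.
by apply: etrans (congr1 (+%R^~ _) (e1 X)) _; rewrite /= addrAC addrC.
Qed.

End Along.

(** * Algebra of curvature tensors *)

Section CurvatureAlgebra.
Context {R : realType} {V : zmodType}.
Variable Q : V -> V -> V -> V -> R.
Hypothesis QN12 : forall A B C D, Q A B C D = - Q B A C D.
Hypothesis QN34 : forall A B C D, Q A B C D = - Q A B D C.
Hypothesis bianchi : forall A B C D, Q A B C D + Q B C A D + Q C A B D = 0.
Hypothesis QD4 : forall A B C D D', Q A B C (D + D') = Q A B C D + Q A B C D'.

(** The octahedron argument: a signed sum of the four Bianchi identities on
    A, B, C, D. *)
Lemma curvature_pair_sym A B C D : Q A B C D = Q C D A B.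
Proof.
have key A' B' C' D' : Q B' C' A' D' = Q A' D' B' C'; last exact: key.
have H1 := bianchi A' B' C' D'; have H2 := bianchi B' C' D' A'.
have H3 := bianchi C' D' A' B'; have H4 := bianchi D' A' B' C'.
have := QN34 A' B' D' C'; have := QN34 C' D' B' A'; have := QN34 B' C' D' A'.
have := QN34 D' A' B' C'; have := QN12 A' C' D' B'; have := QN34 C' A' D' B'.
have := QN12 B' D' A' C'; have := QN34 D' B' A' C'; have := QN12 D' A' C' B'.
have := QN34 A' D' C' B'; lra.
Qed.

Let QD3 A B C C' D : Q A B (C + C') D = Q A B C D + Q A B C' D.
Proof. by rewrite QN34 QD4 opprD -!QN34. Qed.

Let QD1 A A' B C D : Q (A + A') B C D = Q A B C D + Q A' B C D.
Proof. by rewrite !(curvature_pair_sym _ _ C D) QD3. Qed.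

Let QD2 A B B' C D : Q A (B + B') C D = Q A B C D + Q A B' C D.
Proof. by rewrite !(curvature_pair_sym _ _ C D) QD4. Qed.

Let Q04 A B C : Q A B C 0 = 0.
Proof. by have := QD4 A B C 0 0; rewrite addr0; lra. Qed.

Let QN4 A B C D : Q A B C (- D) = - Q A B C D.
Proof. by have := QD4 A B C D (- D); rewrite subrr Q04; lra. Qed.

Let QN3 A B C D : Q A B (- C) D = - Q A B C D.
Proof. by rewrite QN34 QN4 -QN34. Qed.

Let QN1 A B C D : Q (- A) B C D = - Q A B C D.
Proof. by rewrite (curvature_pair_sym _ _ C D) QN3 -curvature_pair_sym. Qed.

Let QN2 A B C D : Q A (- B) C D = - Q A B C D.
Proof. by rewrite (curvature_pair_sym _ _ C D) QN4 -curvature_pair_sym. Qed.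

Variable J : V -> V.
Hypothesis JD : {morph J : A B / A + B}.
Hypothesis JJ : forall A, J (J A) = - A.
Hypothesis QJ : forall A B C D, Q A B (J C) (J D) = Q A B C D.

Let JN A : J (- A) = - J A.
Proof. by rewrite -JJ -JJ JJ. Qed.

Let QJ12 A B C D : Q (J A) (J B) C D = Q A B C D.
Proof. by rewrite curvature_pair_sym QJ -curvature_pair_sym. Qed.

Variables (c : R) (s : V -> R).
Hypothesis Qhol : forall A, Q A (J A) (J A) A = 4 * c * s A ^+ 2.

(** Adding the quartic identities for W + U and W - U cancels the terms odd in U;
    of the six terms of degree 2 in U, two equal the first and four the second
    curvature on the left-hand side. *)
Lemma holomorphic_polarization W U :
  s (W + U) = s W + s U -> s (W - U) = s W + s U ->
  2 * Q W (J W) (J U) U + 4 * Q W (J U) (J U) W = 8 * c * (s W * s U).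
Proof.
move=> sD sB; have := Qhol (W + U); have := Qhol (W - U).
rewrite sD sB !JD !JN !(QD1, QD2, QD3, QD4, QN1, QN2, QN3, QN4).
have HW := Qhol W; have HU := Qhol U.
have e1 : Q U (J U) (J W) W = Q W (J W) (J U) U.
  by rewrite curvature_pair_sym QN12 QN34 opprK.
have e2 : Q W (J U) (J W) U = Q W (J U) (J U) W.
  by rewrite -[in LHS]QJ JJ QN3 QN34 opprK.
have e3 : Q U (J W) (J U) W = Q W (J U) (J U) W.
  by rewrite -e2 curvature_pair_sym QN12 QN34 opprK.
have e4 : Q U (J W) (J W) U = Q W (J U) (J U) W.
  by rewrite -QJ12 JJ QN2 QN12 opprK e2.
rewrite e1 e2 e3 e4 HW HU; lra.
Qed.

(** Applying the polarization to J W as well shows that the totally real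
    curvatures of (W, U) and (W, J U) agree; the Bianchi identity then expresses
    the mixed one as their sum. *)
Lemma holomorphic_bisectional W U :
  s (W + U) = s W + s U -> s (W - U) = s W + s U ->
  s (J W + U) = s W + s U -> s (J W - U) = s W + s U -> s (J W) = s W ->
  Q W (J W) (J U) U = 2 * c * (s W * s U).
Proof.
move=> sD sB sJD sJB sJ; have H1 := holomorphic_polarization sD sB.
have := holomorphic_polarization (W := J W) (U := U); rewrite sJ => /(_ sJD sJB).
rewrite !QJ12 QJ => H2.
have := bianchi W (J W) (J U) U.
rewrite QJ12 (QN12 (J U) W) => H3.
have e2 : Q W (J U) (J W) U = Q W (J U) (J U) W.
  by rewrite -[in LHS]QJ JJ QN3 QN34 opprK.
rewrite e2 in H3.
by have := QN34 W U W U; lra.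
Qed.

End CurvatureAlgebra.

(** * Symmetries of the curvature of a metric *)

Section Curvature.
Context {R : realType}.
Variables (N : nat) (U : set 'rV[R]_N) (G : 'rV[R]_N -> 'M[R]_N).
Hypothesis gU : metric_on U G.
Implicit Types X Y Z W : 'rV[R]_N.

Local Notation Gam := (christoffel G).

Lemma mul_jacobian_id X x : X *m 'J id x = X.
Proof. by rewrite -deriveEjacobian ?derive_id//; exact: ex_diff. Qed.

Lemma nabla_along_id X V : nabla_along G id X V = nabla G X V.
Proof.
by apply/funext => x; rewrite /nabla_along /nabla mul_jacobian_id.
Qed.

Lemma curvatureN x X Y Z : curvature G x X Y Z = - curvature G x Y X Z.
Proof. by rewrite /curvature opprB. Qed.

Lemma nabla_eq_on X (A B : 'rV[R]_N -> 'rV[R]_N) x : U x ->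
  (forall z, U z -> A z = B z) -> nabla G X A x = nabla G X B x.
Proof.
move=> Ux E; have e := open_eq_derive X (metric_open gU) Ux E.
exact: (congr2 +%R e (congr1 (Gam x X) (E x Ux))).
Qed.

Lemma curvature_bianchi x X Y Z : U x ->
  curvature G x X Y Z + curvature G x Y Z X + curvature G x Z X Y = 0.
Proof.
move=> Ux; have E A B : nabla G A (cst B) = fun z => Gam z A B.
  exact: nabla_cst.
have S A B C : nabla G A (fun z => Gam z B C) x = nabla G A (fun z => Gam z C B) x.
  by apply: (nabla_eq_on A Ux) => z Uz; exact: (christoffelC gU B C Uz).
rewrite /curvature !E (S Y Z X) (S Z Y X) (S X Z Y).
have cyc (a b d : 'rV[R]_N) : a - b + (b - d) + (d - a) = 0.
  by apply/rowP => j; rewrite !mxE; ring.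
exact: cyc.
Qed.

Lemma nabla_metric X (A B : 'rV[R]_N -> 'rV[R]_N) x : U x ->
  differentiable A x -> differentiable B x ->
  'D_X (fun z => bform (G z) (A z) (B z)) x =
    bform (G x) (nabla G X A x) (B x) + bform (G x) (A x) (nabla G X B x).
Proof.
move=> Ux dA dB.
have [_] := nabla_along_metric gU (metric_open gU) (fun _ => id) (twice_diff_id U) X Ux dA dB.
by rewrite !nabla_along_id.
Qed.

Lemma nabla_nabla_metric X Y Z W x : U x ->
  'D_X ('D_Y (fun z => bform (G z) Z W)) x =
    bform (G x) (nabla G X (nabla G Y (cst Z)) x) W
    + bform (G x) (nabla G Y (cst Z) x) (nabla G X (cst W) x)
    + (bform (G x) (nabla G X (cst Z) x) (nabla G Y (cst W) x)
    + bform (G x) Z (nabla G X (nabla G Y (cst W)) x)).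
Proof.
move=> Ux; have Uo := metric_open gU.
have dN T : differentiable (nabla G Y (cst T)) x.
  by rewrite nabla_cst; exact: (christoffel_differentiable gU).
have dc T : differentiable (cst T : 'rV[R]_N -> 'rV[R]_N) x.
  exact: differentiable_cst.
pose f1 z := bform (G z) (nabla G Y (cst Z) z) W.
pose f2 z := bform (G z) Z (nabla G Y (cst W) z).
have E z : U z -> 'D_Y (fun z => bform (G z) Z W) z = f1 z + f2 z.
  move=> Uz; exact: (nabla_metric Y Uz (differentiable_cst Z z) (differentiable_cst W z)).
apply: etrans (open_eq_derive X Uo Ux E) _.
have D1 : derivable f1 x X.
  have [d _] := nabla_along_metric gU Uo (fun _ => id) (twice_diff_id U) X Ux (dN Z) (dc W).
  exact: diff_derivable d.
have D2 : derivable f2 x X.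
  have [d _] := nabla_along_metric gU Uo (fun _ => id) (twice_diff_id U) X Ux (dc Z) (dN W).
  exact: diff_derivable d.
exact: (etrans (@deriveD _ _ _ f1 f2 x X D1 D2)
  (congr2 +%R (nabla_metric X Ux (dN Z) (dc W)) (nabla_metric X Ux (dc Z) (dN W)))).
Qed.

Lemma mixed_terms_cancel (a b p q d e : R) :
  a + p + (q + b) = d + q + (p + e) -> a - d = - (b - e).
Proof. by move=> ?; lra. Qed.

(** Two applications of the metric property to the function g(Z, W), whose mixed
    second derivatives agree. *)
Lemma curvature_skew x X Y Z W : U x ->
  bform (G x) (curvature G x X Y Z) W = - bform (G x) (curvature G x X Y W) Z.
Proof.
move=> Ux; have Uo := metric_open gU.
have [d1 d2] := metric_twice_diff gU Z W.
have E := etrans (esym (nabla_nabla_metric X Y Z W Ux))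
  (etrans (derive_comm_scalar Uo Ux d1 (d2 Y x Ux) (d2 X x Ux))
    (nabla_nabla_metric Y X Z W Ux)).
apply: etrans (bformBl _ _ _ _) _; apply: etrans (mixed_terms_cancel E) _.
by congr (- _); rewrite (metricC gU _ Z Ux); exact: esym (bformBr _ _ _ _).
Qed.

(** Differentiate the field Z J, with Z constant, twice: J is parallel and comes
    out of both derivatives.  The Ricci identity, here along the identity map,
    identifies the commutator with the curvature applied to Z J, although this
    field does not have constant components. *)
Lemma curvature_J (J : 'rV[R]_N -> 'M[R]_N) x X Y Z :
  twice_diff_on U J ->
  (forall x, U x -> forall X Y,
    nabla G X (fun z => Y *m J z) x - nabla G X (cst Y) x *m J x = 0) ->
  U x -> curvature G x X Y (Z *m J x) = curvature G x X Y Z *m J x.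
Proof.
move=> [J1 J2] Jpar Ux; have Uo := metric_open gU.
have V2 : twice_diff_on U (fun z => Z *m J z).
  have H := twice_diff_mx_linear (mulmx Z) Uo (conj J1 J2); exact: H.
have := curvature_along gU Uo (fun _ => id) (twice_diff_id U) X Y V2 Ux.
rewrite !mul_jacobian_id !nabla_along_id => <-.
have E A B : nabla G A (nabla G B (fun z => Z *m J z)) x = nabla G A (nabla G B (cst Z)) x *m J x.
  have dN : differentiable (nabla G B (cst Z)) x.
    by rewrite nabla_cst; exact: (christoffel_differentiable gU).
  have [_ H] := nabla_along_J Uo (fun _ => id) (twice_diff_id U) J1 Jpar A Ux dN.
  have e V : nabla G A V x = nabla_along G id A V x by rewrite nabla_along_id.
  rewrite [RHS](congr1 (mulmx^~ (J x)) (e _)); apply: etrans _ H; apply: etrans _ (e _).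
  apply: (nabla_eq_on A Ux) => z Uz.
  by apply/eqP; rewrite -subr_eq0; apply/eqP; exact: Jpar.
apply: etrans (congr2 (fun a b => a - b) (E X Y) (E Y X)) _.
exact: esym (mulmxBl _ _ _).
Qed.

End Curvature.

(** * Kaehler metrics of constant holomorphic curvature *)

Section KaehlerChart.
Context {R : realType}.

(** The part of a Kaehler structure that lives in a single chart. *)
Record kaehler_on (N : nat) (U : set 'rV[R]_N) (G J : 'rV[R]_N -> 'M[R]_N) : Prop := {
  kaehler_metric : metric_on U G;
  kaehlerJ_twice_diff : twice_diff_on U J;
  kaehler_sqr : forall x, U x -> J x *m J x = - 1%:M;
  kaehler_hermitian : forall x, U x -> forall X Y,
    bform (G x) (X *m J x) (Y *m J x) = bform (G x) X Y;
  kaehler_parallel : forall x, U x -> forall X Y,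
    nabla G X (fun z => Y *m J z) x - nabla G X (cst Y) x *m J x = 0 }.

Variables (N : nat) (U : set 'rV[R]_N) (G J : 'rV[R]_N -> 'M[R]_N).
Hypothesis kU : kaehler_on U G J.
Let gU := kaehler_metric kU.
Implicit Types X Y Z W : 'rV[R]_N.

Lemma mulJJ x X : U x -> X *m J x *m J x = - X.
Proof. by move=> Ux; rewrite -mulmxA (kaehler_sqr kU Ux) mulmxN mulmx1. Qed.

Lemma bformJ_skew x X Y : U x ->
  bform (G x) (X *m J x) Y = - bform (G x) X (Y *m J x).
Proof.
by move=> Ux; rewrite -(kaehler_hermitian kU Ux) (mulJJ X Ux) bformNl.
Qed.

Lemma bform_selfJ x X : U x -> bform (G x) X (X *m J x) = 0.
Proof.
move=> Ux; apply: eq_opp0; rewrite -(bformJ_skew X X Ux).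
exact: (metricC gU).
Qed.

Variable c : R.
Hypothesis hol : forall x, U x -> forall X, X != 0 ->
  sectional_curvature G x X (X *m J x) = 4 * c.

Lemma holomorphic_curvature_quartic x X : U x ->
  bform (G x) (curvature G x X (X *m J x) (X *m J x)) X =
  4 * c * bform (G x) X X ^+ 2.
Proof.
move=> Ux; have [->|X0] := eqVneq X 0.
  by rewrite bform0r bform0r expr0n /= mulr0.
have := hol Ux X0; rewrite /sectional_curvature.
rewrite (kaehler_hermitian kU Ux) (bform_selfJ X Ux) expr0n /= subr0 -expr2.
move=> /(canRL (mulfVK _)) -> //.
by rewrite expf_neq0// gt_eqF//; exact: (metric_pos gU Ux).
Qed.

Lemma bform_sqrD x X Y : U x -> bform (G x) X Y = 0 ->
  bform (G x) (X + Y) (X + Y) = bform (G x) X X + bform (G x) Y Y.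
Proof.
move=> Ux XY; rewrite bformDl !bformDr (metricC gU Y X Ux) XY.
by rewrite addr0 add0r.
Qed.

Lemma bform_sqrB x X Y : U x -> bform (G x) X Y = 0 ->
  bform (G x) (X - Y) (X - Y) = bform (G x) X X + bform (G x) Y Y.
Proof.
move=> Ux XY; rewrite (bform_sqrD Ux) ?bformNr ?XY ?oppr0//.
by rewrite bformNl opprK.
Qed.

(** Orthogonality makes the squared norm additive on W and Z and on J W and Z,
    as polarization requires. *)
Lemma space_form_curvature x W Z : U x ->
  bform (G x) W Z = 0 -> bform (G x) W (Z *m J x) = 0 ->
  bform (G x) (curvature G x W (W *m J x) (Z *m J x)) Z =
  2 * c * (bform (G x) W W * bform (G x) Z Z).
Proof.
move=> Ux WZ WJZ.
have JWZ : bform (G x) (W *m J x) Z = 0 by rewrite (bformJ_skew _ _ Ux) WJZ oppr0.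
apply: (@holomorphic_bisectional R 'rV[R]_N
  (fun A B C D => bform (G x) (curvature G x A B C) D) _ _ _ _
  (mulmx^~ (J x)) _ _ _ c (fun A => bform (G x) A A) _ W Z).
- by move=> A B C D; rewrite curvatureN bformNl.
- by move=> A B C D; exact: (curvature_skew gU).
- by move=> A B C D; rewrite -!bformDl (curvature_bianchi gU A B C Ux) bform0l.
- by move=> A B C D D'; exact: bformDr.
- by move=> A B; exact: mulmxDl.
- by move=> A; exact: mulJJ.
- move=> A B C D.
  rewrite (curvature_J gU A B C (kaehlerJ_twice_diff kU) (kaehler_parallel kU) Ux).
  exact: (kaehler_hermitian kU Ux).
- by move=> A; exact: holomorphic_curvature_quartic.
- exact: bform_sqrD.
- exact: bform_sqrB.
- by rewrite (bform_sqrD Ux JWZ) (kaehler_hermitian kU Ux).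
- by rewrite (bform_sqrB Ux JWZ) (kaehler_hermitian kU Ux).
- exact: (kaehler_hermitian kU Ux).
Qed.

End KaehlerChart.

(** * The second fundamental form *)

Section Submanifold.
Context {R : realType}.

Variables (n N : nat) (U : set 'rV[R]_N) (G : 'rV[R]_N -> 'M[R]_N).
Variables (D : set 'rV[R]_n) (F : 'rV[R]_n -> 'rV[R]_N).
Hypotheses (gU : metric_on U G) (Do : open D) (FD : forall y, D y -> U (F y)).
Hypotheses (F2 : twice_diff_on D F) (F3 : forall v, twice_diff_on D ('D_v F)).
Hypothesis Fimm : forall y, D y -> row_free ('J F y).

Local Notation nab := (nabla_along G F).
Local Notation push X y := ((X : 'rV[R]_n) *m 'J F y).
Local Notation ghat := (induced_metric G F).
Local Notation h := (second_fundamental_form G F).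

Lemma push_twice_diff X : twice_diff_on D (fun z => push X z).
Proof.
by apply: (twice_diff_eq Do _ (F3 X)) => z Dz; rewrite (pushE F2 X Dz).
Qed.

Lemma bform_induced X Y y :
  bform (ghat y) X Y = bform (G (F y)) (push X y) (push Y y).
Proof. by rewrite /bform /induced_metric trmx_mul !mulmxA. Qed.

Lemma push_eq0 X y : D y -> push X y = 0 -> X = 0.
Proof. by move=> Dy /eqP; rewrite mulmx_free_eq0 ?Fimm// => /eqP. Qed.

Lemma derive_induced X Y Z y : D y ->
  dmetric ghat X Y Z y =
  bform (G (F y)) (nab X (fun z => push Y z) y) (push Z y)
  + bform (G (F y)) (push Y y) (nab X (fun z => push Z z) y).
Proof.
move=> Dy; have [PY _] := push_twice_diff Y; have [PZ _] := push_twice_diff Z.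
have E z : D z -> bform (ghat z) Y Z = bform (G (F z)) (push Y z) (push Z z).
  by move=> _; exact: bform_induced.
apply: etrans (open_eq_derive X Do Dy E) _.
by have [] := nabla_along_metric gU Do FD F2 X Dy (PY y Dy) (PZ y Dy).
Qed.

Lemma nabla_push_differentiable X Y y : D y ->
  differentiable (nab X (fun z => push Y z)) y.
Proof.
exact: (nabla_along_differentiable gU Do FD F2 X (push_twice_diff Y)).
Qed.

(** The induced metric is quadratic in the derivatives of F; the metric property
    of the derivative along F gives its own derivatives in terms of D_X e_Y,
    which is differentiable because F is three times so. *)
Lemma induced_metric_on : metric_on D ghat.
Proof.
have sym y : D y -> (ghat y)^T = ghat y.
  move=> Dy; rewrite /induced_metric !trmx_mul trmxK.
  by rewrite (metric_sym gU (FD Dy)) mulmxA.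
split=> // [y Dy X X0|X Y].
  rewrite bform_induced; apply: (metric_pos gU (FD Dy)).
  by apply: contra_neq X0; exact: push_eq0.
have [PX _] := push_twice_diff X; have [PY _] := push_twice_diff Y.
split=> [y Dy|v y Dy].
  apply: (open_eq_differentiable Do Dy (f := fun z => bform (G (F z)) (push X z) (push Y z))).
    by move=> z _; rewrite bform_induced.
  by have [] := nabla_along_metric gU Do FD F2 0 Dy (PX y Dy) (PY y Dy).
apply: (open_eq_differentiable Do Dy (f := fun z =>
    bform (G (F z)) (nab v (fun z => push X z) z) (push Y z)
  + bform (G (F z)) (push X z) (nab v (fun z => push Y z) z))).
  by move=> z Dz; exact: esym (derive_induced v X Y Dz).
have nX := nabla_push_differentiable v X Dy.
have nY := nabla_push_differentiable v Y Dy.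
have [d1 _] := nabla_along_metric gU Do FD F2 0 Dy nX (PY y Dy).
have [d2 _] := nabla_along_metric gU Do FD F2 0 Dy (PX y Dy) nY.
exact: differentiableD.
Qed.

Lemma koszul_solve (a b d : R) :
  2^-1 * (a + b + (a + d) - (b + d)) = a.
Proof. by field. Qed.

(** Gauss formula: the tangential part of D_X e_Y is the Levi-Civita connection
    of the induced metric, as both satisfy the Koszul identity. *)
Lemma gauss_tangential X Y Z y : D y ->
  bform (G (F y)) (nab X (fun z => push Y z) y) (push Z y) =
  bform (ghat y) (christoffel ghat y X Y) Z.
Proof.
move=> Dy; rewrite (koszul induced_metric_on X Y Z Dy).
rewrite (derive_induced X Y Z Dy) (derive_induced Y X Z Dy) (derive_induced Z X Y Dy).
rewrite (nabla_along_pushC gU Do FD F2 Y X Dy) (nabla_along_pushC gU Do FD F2 Z X Dy).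
rewrite (nabla_along_pushC gU Do FD F2 Z Y Dy).
rewrite (metricC gU (push Y y) _ (FD Dy)).
rewrite [in RHS](metricC gU (push X y) _ (FD Dy)).
by rewrite koszul_solve.
Qed.

Lemma second_fundamental_formE X Y y :
  h y X Y = nab X (fun z => push Y z) y - push (christoffel ghat y X Y) y.
Proof. by rewrite /second_fundamental_form nabla_cst. Qed.

(** This is where the intrinsic Christoffel symbols in the definition of h are
    recognized as an orthogonal projection. *)
Lemma second_fundamental_form_normal X Y Z y : D y ->
  bform (G (F y)) (h y X Y) (push Z y) = 0.
Proof.
move=> Dy; rewrite second_fundamental_formE bformBl (gauss_tangential X Y Z Dy).
by rewrite -bform_induced subrr.
Qed.

Lemma second_fundamental_formC X Y y : D y -> h y X Y = h y Y X.
Proof.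
move=> Dy; rewrite !second_fundamental_formE (nabla_along_pushC gU Do FD F2 X Y Dy).
by rewrite (christoffelC induced_metric_on X Y Dy).
Qed.

Lemma second_fundamental_form0l Y y : D y -> h y 0 Y = 0.
Proof.
move=> Dy; rewrite second_fundamental_formE /nabla_along derive0 mul0mx.
have G0 := christoffel_linl gU (-1) 0 0 (push Y y) (FD Dy).
have G1 := christoffel_linl induced_metric_on (-1) 0 0 Y Dy.
move: G0 G1; rewrite !scaleN1r !oppr0 !addr0 !addNr => -> ->.
by rewrite mul0mx subr0 addr0.
Qed.

(** Orthogonal projection, written with the inverse of the Gram matrix. *)
Lemma tangential_component_exists V y : D y ->
  exists Z, tangential_component G F y V Z.
Proof.
move=> Dy; have u := metric_unit induced_metric_on Dy.
exists (V *m G (F y) *m ('J F y)^T *m invmx (ghat y)) => W.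
rewrite bformBl -bform_induced /bform mulmxKV// trmx_mul !mulmxA.
exact: subrr.
Qed.

End Submanifold.

(** * Submanifolds of maximal CR dimension *)

Section MaximalCR.
Context {R : realType}.

Lemma skew_odd_singular n (A : 'M[R]_n) : odd n -> A^T = - A -> \det A = 0.
Proof.
move=> n_odd AT; apply: eq_opp0.
by rewrite -[in LHS]det_tr AT -scaleN1r detZ -signr_odd n_odd expr1 mulN1r.
Qed.

(** The first basis vector over C, together with its image by J. *)
Lemma complex_dim_vector N (J H : 'M[R]_N) k : complex_dim J H k -> (0 < k)%N ->
  exists b : 'rV[R]_N, [/\ b != 0, (b <= H)%MS & (b *m J <= H)%MS].
Proof.
move=> [B [Bfree /eqmxP BH]] k0; pose i0 := Ordinal k0.
exists (row i0 B); split.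
- apply/eqP => b0; have : (delta_mx 0 (lshift k i0) : 'rV[R]_(k + k)) *m col_mx B (B *m J) = 0.
    by rewrite -rowE rowKu.
  move/eqP; rewrite mulmx_free_eq0// => /eqP/matrixP/(_ 0 (lshift k i0)).
  by rewrite !mxE !eqxx => /eqP; rewrite oner_eq0.
- rewrite -BH; apply: submx_trans (row_sub i0 B) _.
  by rewrite -addsmxE addsmxSl.
- rewrite -BH -row_mul; apply: submx_trans (row_sub i0 (B *m J)) _.
  by rewrite -addsmxE addsmxSr.
Qed.

Variables (n N : nat) (U : set 'rV[R]_N) (G J : 'rV[R]_N -> 'M[R]_N).
Variables (D : set 'rV[R]_n) (F : 'rV[R]_n -> 'rV[R]_N).
Hypotheses (kU : kaehler_on U G J) (Do : open D) (FD : forall y, D y -> U (F y)).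
Hypotheses (F2 : twice_diff_on D F) (F3 : forall v, twice_diff_on D ('D_v F)).
Hypothesis Fimm : forall y, D y -> row_free ('J F y).

Let gU := kaehler_metric kU.
Local Notation nab := (nabla_along G F).
Local Notation push X y := ((X : 'rV[R]_n) *m 'J F y).
Local Notation ghat := (induced_metric G F).
Local Notation h := (second_fundamental_form G F).

(** The form (X, Y) |-> g(J e_X, e_Y) is skew on a space of odd dimension. *)
Lemma characteristic_vector y : D y -> odd n ->
  exists2 u : 'rV[R]_n, u != 0 &
    forall W, bform (G (F y)) (push u y *m J (F y)) (push W y) = 0.
Proof.
move=> Dy n_odd; set T := 'J F y.
pose Om := T *m J (F y) *m G (F y) *m T^T.
have OmE X Y : bform Om X Y = bform (G (F y)) (push X y *m J (F y)) (push Y y).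
  by rewrite /bform /Om trmx_mul !mulmxA.
have /eqP/det0P [u u0 uO] : \det Om = 0.
  apply: (skew_odd_singular n_odd); apply/matrixP => i j.
  rewrite mxE -[LHS]bform_delta [RHS]mxE -bform_delta !OmE.
  rewrite (bformJ_skew kU _ _ (FD Dy)); congr (- _); exact: (metricC gU _ _ (FD Dy)).
exists u => // W; rewrite -OmE /bform uO mul0mx mxE //.
Qed.

Hypothesis Hh : forall y, D y -> forall X FX Y,
  tangential_component G F y (push X y *m J (F y)) FX ->
  h y FX Y = h y X Y *m J (F y).

(** J h(X, Y) is normal, being a value of h by the hypothesis on h, and J is
    skew for g. *)
Lemma second_fundamental_form_J_normal X Y Z y : D y ->
  bform (G (F y)) (h y X Y) (push Z y *m J (F y)) = 0.
Proof.
move=> Dy; have [FX HFX] :=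
  tangential_component_exists gU Do FD F2 F3 Fimm (push X y *m J (F y)) Dy.
apply: oppr_inj; rewrite oppr0 -(bformJ_skew kU _ _ (FD Dy)) -(Hh Dy Y HFX).
exact: (second_fundamental_form_normal gU Do FD F2 F3 Fimm).
Qed.

Section Characteristic.
Variables (y : 'rV[R]_n) (u : 'rV[R]_n).
Hypothesis Dy : D y.
Hypothesis uP : forall W, bform (G (F y)) (push u y *m J (F y)) (push W y) = 0.

(** J e_u has zero tangential component, so J h(u, Y) = h(0, Y). *)
Lemma second_fundamental_form_characteristic Y : h y u Y = 0.
Proof.
have u0 : tangential_component G F y (push u y *m J (F y)) 0.
  by move=> W; rewrite mul0mx subr0; exact: uP.
have := Hh Dy Y u0.
rewrite (second_fundamental_form0l gU Do FD F2 F3 Fimm Y Dy) => hJ.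
apply: oppr_inj; rewrite oppr0 -(mulJJ kU _ (FD Dy)) -hJ; exact: mul0mx.
Qed.

(** The derivative at y of the vanishing function g(h(X, Y), J e_u), where u is a
    constant vector; u is characteristic at y only. *)
Lemma nabla_nabla_push_characteristic W X Y :
  bform (G (F y)) (nab W (nab X (fun z => push Y z)) y)
    (push u y *m J (F y)) = 0.
Proof.
have Jdiff := (kaehlerJ_twice_diff kU).1.
have iU := induced_metric_on gU Do FD F2 F3 Fimm.
pose gam z := christoffel ghat z X Y.
have dgam : differentiable gam y by exact: (christoffel_differentiable iU).
have dA : differentiable (nab X (fun z => push Y z)) y.
  exact: (nabla_push_differentiable gU Do FD F2 F3 X Y Dy).
have lin z : D z -> forall a (v w : 'rV[R]_n),
    push (a *: v + w) z = a *: push v z + push w z.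
  by move=> _ a v w; rewrite mulmxDl scalemxAl.
have [dT eT] := derive_linear_family (L := fun z v => push v z) Do Dy lin
  (fun v => push_differentiable Do F2 v Dy) dgam.
have dh : differentiable (fun z => h z X Y) y.
  apply: (open_eq_differentiable Do Dy
    (f := fun z => nab X (fun z => push Y z) z - push (gam z) z)).
    by move=> z _; rewrite second_fundamental_formE.
  exact: differentiableB.
have [dJ eJ] := nabla_along_J Do FD F2 Jdiff (kaehler_parallel kU) W Dy
  (push_differentiable Do F2 u Dy).
have [_ em] := nabla_along_metric gU Do FD F2 W Dy dh dJ.
have z0 : 'D_W (fun z => bform (G (F z)) (h z X Y) (push u z *m J (F z))) y = 0.
  rewrite -(derive_cst (0 : R) y W); apply: (open_eq_derive W Do Dy) => z Dz.
  exact: second_fundamental_form_J_normal.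
(* D_W e_u is tangent because h(W, u) = h(u, W) = 0. *)
have nabu : nab W (fun z => push u z) y = push (christoffel ghat y W u) y.
  apply/eqP; rewrite -subr_eq0; apply/eqP.
  rewrite -second_fundamental_formE.
  rewrite (second_fundamental_formC gU Do FD F2 F3 Fimm W u Dy).
  exact: second_fundamental_form_characteristic.
have nz : bform (G (F y)) (nab W (fun z => h z X Y) y) (push u y *m J (F y)) = 0.
  move: em; rewrite z0 eJ nabu (second_fundamental_form_J_normal X Y _ Dy) addr0.
  exact: esym.
have pu v : bform (G (F y)) (push v y) (push u y *m J (F y)) = 0.
  by rewrite (metricC gU _ _ (FD Dy)); exact: uP.
have AE : nab X (fun z => push Y z) =
    (fun z => h z X Y + push (gam z) z).
  by apply/funext => z; rewrite second_fundamental_formE subrK.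
(* Differentiating the tangential part of D_X e_Y yields only tangent vectors
   and a value of h. *)
have nT : nab W (fun z => push (gam z) z) y =
    h y W (gam y) + push (christoffel ghat y W (gam y)) y + push ('D_W gam y) y.
  rewrite second_fundamental_formE subrK.
  exact: etrans (congr1 (+%R^~ _) (eT W)) (addrAC _ _ _).
rewrite AE (nabla_alongD gU FD W Dy dh dT) nT.
apply: etrans (bformDl _ _ _ _) _; rewrite nz add0r.
apply: etrans (bformDl _ _ _ _) _; rewrite pu addr0.
apply: etrans (bformDl _ _ _ _) _; rewrite pu addr0.
exact: second_fundamental_form_J_normal.
Qed.

(** The component along J e_u of the Codazzi equation, obtained from the Ricci
    identity because both iterated derivatives are orthogonal to J e_u. *)
Lemma curvature_characteristic W X Y :
  bform (G (F y)) (curvature G (F y) (push W y) (push X y) (push Y y))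
    (push u y *m J (F y)) = 0.
Proof.
have E := curvature_along gU Do FD F2 W X (push_twice_diff Do F2 F3 Y) Dy.
apply: etrans (congr1 (fun v => bform _ v _) (esym E)) _.
have e1 := nabla_nabla_push_characteristic W X Y.
have e2 := nabla_nabla_push_characteristic X W Y.
apply: etrans (bformBl _ _ _ _) _; rewrite [X in X - _]e1.
rewrite [X in _ - X]e2; exact: subrr.
Qed.

End Characteristic.

Variable c : R.
Hypothesis hol : forall x, U x -> forall X, X != 0 ->
  sectional_curvature G x X (X *m J x) = 4 * c.

(** The vector b below lies in the maximal invariant subspace; it is orthogonal to
    e_u and J e_u because b and J b are tangent while J e_u is normal. *)
Lemma maximal_CR_flat y k : (3 <= n)%N -> D y -> k.*2.+1 = n ->
  complex_dim (J (F y)) (('J F y *m J (F y)) :&: 'J F y)%MS k -> c = 0.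
Proof.
move=> n3 Dy kn Hk; have Uy := FD Dy.
have k0 : (0 < k)%N by move: n3; rewrite -kn; case: (k).
have n_odd : odd n by rewrite -kn /= odd_double.
have [b [b0 bH bJH]] := complex_dim_vector Hk k0.
have /submxP[w bw] : (b <= 'J F y)%MS by move: bH; rewrite sub_capmx => /andP[].
have /submxP[x bx] : (b *m J (F y) <= 'J F y)%MS.
  by move: bJH; rewrite sub_capmx => /andP[].
have [u u0 uP] := characteristic_vector Dy n_odd.
have e0 : push u y != 0 by apply: contra_neq u0; exact: (push_eq0 Fimm Dy).
have bu : bform (G (F y)) b (push u y) = 0.
  rewrite -(kaehler_hermitian kU Uy) bx (metricC gU _ _ Uy); exact: uP.
have bJu : bform (G (F y)) b (push u y *m J (F y)) = 0.
  by rewrite bw (metricC gU _ _ Uy); exact: uP.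
have := space_form_curvature kU hol Uy bu bJu.
rewrite (curvature_skew gU _ _ _ _ Uy) bx bw (curvature_characteristic Dy uP) oppr0 -bw.
have /lt0r_neq0 b2 := metric_pos gU Uy b0.
have /lt0r_neq0 u2 := metric_pos gU Uy e0.
move/esym/eqP; rewrite !mulf_eq0 (negbTE b2) (negbTE u2) !orbF pnatr_eq0 /=.
by move/eqP.
Qed.

End MaximalCR.

(** * Passage to charts *)

Section Charts.
Context {R : realType}.

Lemma local_dom_open (n m : nat) (S T : topologicalType)
    (f : S -> T) (a : chart R n S) (b : chart R m T) :
  continuous f -> open (local_dom f a b).
Proof.
move=> fc; rewrite openE => y [ay by_]; rewrite /interior.
have ai := chart_inv_cont (c := a).
rewrite continuous_open_subspace in ai; last exact: chart_cod_open.
have aiy : {for y, continuous (chart_inv a)} by apply: ai; rewrite inE.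
have H : \forall z \near y, chart_dom b (f (chart_inv a z)).
  apply: (continuous_comp aiy (fc _)).
  exact: (open_nbhs_nbhs (conj (chart_dom_open b) by_)).
have K : nbhs y (chart_cod a).
  by apply: open_nbhs_nbhs; split => //; exact: chart_cod_open.
exact: filterI K H.
Qed.

Lemma kaehler_on_chart N (M : kaehlerManifold R N) (b : mfd_index M) :
  kaehler_on (chart_cod (mfd_chart b)) (kg b) (kJ b).
Proof.
have o : open (chart_cod (mfd_chart b)) by exact: chart_cod_open.
split; first split=> //.
- exact: kg_sym.
- exact: kg_pos.
- by move=> X Y; apply: bform_twice_diff => //; apply: smooth_twice_diff; exact: kg_smooth.
- by apply: smooth_twice_diff; exact: kJ_smooth.
- exact: kJ_sqr.
- exact: kJ_hermitian.
- exact: kJ_parallel.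
Qed.

End Charts.

Theorem theorem5 (R : realType) (n p : nat) (c : R)
    (Mbar : kaehlerManifold R (n + p)%N) (M : manifold R n) (f : M -> Mbar)
    (n_ge3 : (3 <= n)%N) (p_gt0 : (0 < p)%N)
    (Mbar_space_form : constant_holomorphic_curvature Mbar (4 * c))
    (f_immersion : immersion f)
    (f_CR : maximal_CR_dimension f)
    (f_h : h_complex_linear f) :
  c = 0.
Proof.
have [x] := mfd_inhabited M.
have [a ax] := mfd_cover x; have [b bfx] := mfd_cover (f x).
have [[fc fs] fi] := f_immersion.
pose y := chart_map (mfd_chart a) x.
have Dy : local_dom f (mfd_chart a) (mfd_chart b) y.
  by split; [exact: chart_mapP|rewrite /y chart_mapK].
have [k [kn Hk]] := f_CR a b y Dy.
have Do : open (local_dom f (mfd_chart a) (mfd_chart b)).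
  exact: local_dom_open.
apply: (maximal_CR_flat (F := local_rep f (mfd_chart a) (mfd_chart b)) (y := y)
  (kaehler_on_chart b) Do _ _ _ _ _ _ n_ge3 Dy kn Hk).
- by move=> z [_ bz]; exact: chart_mapP.
- exact: smooth_twice_diff (fs a b).
- by move=> v; apply: smooth_twice_diff; apply: smooth_derive; exact: fs.
- by move=> z; exact: fi.
- by move=> z Dz X FX Y; exact: f_h.
- exact: Mbar_space_form.
Qed.
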